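(* Let $(X_N)_{N\in\mathbb{N}}$ be a self-adjoint random matrix ensemble and let $M>0$, $K>0$ be constants such that: (i) for all $m,n\in\mathbb{N}$ the limits $\alpha_n=\lim_{N\to\infty}\frac1N\mathbb{E}(\mathrm{Tr}(X_N^n))$ and $\alpha_{m,n}=\lim_{N\to\infty}\mathrm{Cov}(\mathrm{Tr}(X_N^m),\mathrm{Tr}(X_N^n))$ exist; (ii) $\lim_{N\to\infty}N^8\,\mathbb{P}(\|X_N\|>M)=0$; (iii) for all $f\in C^1(\mathbb{R})$ and $N\in\mathbb{N}$, $\mathrm{Var}(\mathrm{Tr}(f(X_N)))\le K\|f'\|_\infty^2$. Let $\rho:\mathbb{C}[x]\times\mathbb{C}[x]\to\mathbb{C}$ be the bilinear map with $\rho(x^m,x^n)=\alpha_{m,n}$ for $m,n\ge 1$ and $\rho(1,x^n)=\rho(x^n,1)=0$ for $n\ge 0$. Then: (a) $\rho$ extends (identifying a polynomial with its restriction to $[-M,M]$) to a bilinear function on $C^1([-M,M])\times C^1([-M,M])$ satisfying $|\rho(f,g)|\le K\|f'\|_M\|g'\|_M$ for all $f,g\in C^1([-M,M])$. (b) For all $f,g\in\mathcal{S}$, $\lim_{N\to\infty}\mathrm{Cov}(\mathrm{Tr}(f(X_N)),\mathrm{Tr}(g(X_N)))=\rho(f|_M,g|_M)$. (c) There exists $u:[-M,M]^2\to\mathbb{R}$ of bounded Fréchet variation such that, for all $f,g\in C^1([-M,M])$, $$\rho(f,g)=\int_{-M}^M\int_{-M}^M f'(x)g'(y)\,\mathrm{d}u(x,y),$$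 where the double integral is a Fréchet integral.
   Context: A self-adjoint random matrix ensemble $(X_N)_{N}$ is a sequence in which $X_N$ is an $N\times N$ self-adjoint complex random matrix; all moments $\mathbb{E}(\mathrm{Tr}(X_N^n))$ and covariances $\mathrm{Cov}(\mathrm{Tr}(X_N^m),\mathrm{Tr}(X_N^n))$ are assumed finite. $\|X_N\|$ is the operator norm; $\mathrm{Tr}$ is the unnormalized trace; $\mathrm{Tr}(f(X_N))=\sum_k f(\lambda_k)$, with $\lambda_1,\dots,\lambda_N$ the eigenvalues of $X_N$. $\mathrm{Cov}(X,Y)=\mathbb{E}(XY)-\mathbb{E}(X)\mathbb{E}(Y)$ (no complex conjugation) and $\mathrm{Var}(X)=\mathbb{E}|X-\mathbb{E}X|^2$ for complex random variables. $C^1(\mathbb{R})$ is the space of complex-valued functions on $\mathbb{R}$ with continuous derivative; $f|_M$ is the restriction of $f$ to $[-M,M]$; $C^1([-M,M])=\{f|_M: f\in C^1(\mathbb{R})\}$; $\|h\|_M=\sup_{|x|\le M}|h(x)|$; $\|h\|_\infty=\sup_{x\in\mathbb{R}}|h(x)|$ (possibly $+\infty$). $\mathcal{S}=\{f\in C^1(\mathbb{R}): f\text{ is polynomially bounded}\}$. For $u:[-M,M]^2\to\mathbb{R}$ put $\Delta u(s_0,s_1;t_0,t_1)=u(s_1,t_1)-u(s_1,t_0)-u(s_0,t_1)+u(s_0,t_0)$. $u$ has bounded Fréchet variation if the sums $\sum_{i=1}^m\sum_{j=1}^n\sigma_i\theta_j\Delta u(s_{i-1},s_i;t_{j-1},t_j)$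 are uniformly bounded over all $m,n\in\mathbb{N}$, all signs $\sigma_i,\theta_j\in\{\pm1\}$ and all partitions $-M=s_0\le\dots\le s_m=M$, $-M=t_0\le\dots\le t_n=M$. For such $u$ and continuous $f,g$ on $[-M,M]$, the Fréchet integral is $\int_{-M}^M\int_{-M}^M f(x)g(y)\,\mathrm{d}u(x,y)=\lim_{|s|,|t|\to0}\sum_i\sum_j f(\xi_i)g(\eta_j)\Delta u(s_{i-1},s_i;t_{j-1},t_j)$, where $\xi_i\in[s_{i-1},s_i]$, $\eta_j\in[t_{j-1},t_j]$ and $|s|=\max_i(s_i-s_{i-1})$ is the mesh of the partition (the limit is known to exist). *)

(* Defs.v *)
From HB Require Import structures.
From mathcomp Require Import all_boot all_order all_algebra.
From mathcomp Require Import all_classical all_reals all_analysis.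
From mathcomp Require Import complex.

Set Implicit Arguments.
Unset Strict Implicit.
Unset Printing Implicit Defensive.

Import Order.TTheory GRing.Theory Num.Theory.
Import numFieldNormedType.Exports.

Local Open Scope classical_set_scope.
Local Open Scope ring_scope.
Local Open Scope complex_scope.

Notation normc := Normc.normc.

(* [fine] sends infinite values to 0.  When X has finite trace moments, this
   plays no role for the variables Tr(f(X)) and Tr(f(X)) Tr(g(X)) with f, g
   polynomially bounded, nor for f with bounded derivative: they are
   integrable. *)
Definition cintegrable d (T : measurableType d) (R : realType)
    (P : probability T R) (Z : T -> R[i]) : Prop :=
  P.-integrable setT (fun w => (complex.Re (Z w))%:E) /\
  P.-integrable setT (fun w => (complex.Im (Z w))%:E).

Definition cexpectation d (T : measurableType d) (R : realType)
    (P : probability T R) (Z : T -> R[i]) : R[i] :=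
  fine (expectation P (fun w => complex.Re (Z w))) +i*
  fine (expectation P (fun w => complex.Im (Z w))).

Definition ccovariance d (T : measurableType d) (R : realType)
    (P : probability T R) (Z W : T -> R[i]) : R[i] :=
  cexpectation P (fun w => Z w * W w) - cexpectation P Z * cexpectation P W.

Definition cvariance d (T : measurableType d) (R : realType)
    (P : probability T R) (Z : T -> R[i]) : \bar R :=
  expectation P (fun w => normc (Z w - cexpectation P Z) ^+ 2).

(* [trf f A] is Tr(f(A)) for self-adjoint A: the entries of [spectral_diag A]
   are then the eigenvalues of A with multiplicity, and they are real. *)
Definition trf (R : realType) (f : R -> R[i]) n (A : 'M[R[i]]_n) : R[i] :=
  \sum_(k < n) f (complex.Re (spectral_diag A 0 k)).

Definition l2norm (R : realType) n (v : 'cV[R[i]]_n) : R :=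
  Num.sqrt (\sum_(i < n) normc (v i 0) ^+ 2).

Definition opnorm (R : realType) n (A : 'M[R[i]]_n) : R :=
  sup [set l2norm (A *m v) | v in [set v | l2norm v <= 1]].

Definition random_selfadjoint d (T : measurableType d) (R : realType) n
    (X : T -> 'M[R[i]]_n) : Prop :=
  (forall w, X w \is hermsymmx) /\
  (forall i j, measurable_fun setT (fun w => complex.Re (X w i j)) /\
               measurable_fun setT (fun w => complex.Im (X w i j))).

Definition finite_trace_moments d (T : measurableType d) (R : realType)
    (P : probability T R) n (X : T -> 'M[R[i]]_n) : Prop :=
  (forall k, cintegrable P (fun w => \tr (X w ^+ k))) /\
  (forall k l, cintegrable P (fun w => \tr (X w ^+ k) * \tr (X w ^+ l))).

(* The probability space may depend on N.  The index N = 0 (empty matrices)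
   is allowed but carries no content. *)
Definition selfadjoint_ensemble (R : realType) (d : nat -> measure_display)
    (T : forall N, measurableType (d N)) (P : forall N, probability (T N) R)
    (X : forall N, T N -> 'M[R[i]]_N) : Prop :=
  forall N, random_selfadjoint (X N) /\ finite_trace_moments (P N) (X N).

Definition cderive (R : realType) (f : R -> R[i]) : R -> R[i] := fun x =>
  derive1 (fun y => complex.Re (f y)) x +i*
  derive1 (fun y => complex.Im (f y)) x.

Definition C1 (R : realType) : set (R -> R[i]) := [set f : R -> R[i] |
  [/\ forall x, derivable (fun y => complex.Re (f y)) x 1,
      forall x, derivable (fun y => complex.Im (f y)) x 1,
      continuous (fun x => complex.Re (cderive f x)) &
      continuous (fun x => complex.Im (cderive f x))]].

Definition poly_bounded (R : realType) (f : R -> R[i]) : Prop :=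
  exists (c : R) (k : nat), forall x : R, normc (f x) <= c * (1 + `|x| ^+ k).

Definition classS (R : realType) : set (R -> R[i]) :=
  [set f | @C1 R f /\ poly_bounded f].

Definition supnorm (R : realType) (h : R -> R[i]) : \bar R :=
  ereal_sup (range (fun x => (normc (h x))%:E)).

(* only used for h continuous, where the supremum is finite *)
Definition supnorm_seg (R : realType) (M : R) (h : R -> R[i]) : R :=
  sup [set normc (h x) | x in `[- M, M]].

Definition seg (R : realType) (M : R) : Type := {x : R | x \in `[- M, M]}.

Definition restr (R : realType) (M : R) (f : R -> R[i]) : seg M -> R[i] :=
  fun x => f (val x).

Definition C1seg (R : realType) (M : R) : set (seg M -> R[i]) :=
  [set restr f | f in @C1 R].

Definition poly_fun (R : realType) (p : {poly R[i]}) : R -> R[i] :=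
  fun x => p.[x%:C].

Definition bilinear_on (R : realType) (U : Type) (D : set (U -> R[i]))
    (b : (U -> R[i]) -> (U -> R[i]) -> R[i]) : Prop :=
  (forall a F1 F2 G, D F1 -> D F2 -> D G ->
     b (fun x => a * F1 x + F2 x) G = a * b F1 G + b F2 G) /\
  (forall a F G1 G2, D F -> D G1 -> D G2 ->
     b F (fun x => a * G1 x + G2 x) = a * b F G1 + b F G2).

Definition rect_incr (R : realType) (u : R -> R -> R) (s0 s1 t0 t1 : R) : R :=
  u s1 t1 - u s1 t0 - u s0 t1 + u s0 t0.

(* The partition points are s 0, ..., s m; the values of s beyond m are
   irrelevant. *)
Definition is_partition (R : realType) (M : R) (m : nat) (s : nat -> R) :
    Prop :=
  [/\ s 0%N = - M, s m = M & forall i, (i < m)%N -> s i <= s i.+1].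

Definition mesh (R : realType) (m : nat) (s : nat -> R) : R :=
  \big[Num.max/0]_(i < m) (s i.+1 - s i).

Definition is_tagging (R : realType) (m : nat) (s xi : nat -> R) : Prop :=
  forall i, (i < m)%N -> s i <= xi i <= s i.+1.

(* Functions on [-M, M]^2 are represented by functions on R^2; only their
   values on the square are used. *)
Definition bounded_frechet_variation (R : realType) (M : R) (u : R -> R -> R) :
    Prop :=
  exists B : R, forall (m n : nat) (s t : nat -> R) (sigma theta : nat -> bool),
    is_partition M m s -> is_partition M n t ->
    `| \sum_(i < m) \sum_(j < n) (-1) ^+ sigma i * (-1) ^+ theta j *
         rect_incr u (s i) (s i.+1) (t j) (t j.+1) | <= B.

(* the Frechet integral of f(x) g(y) du(x, y) over [-M, M]^2 exists and
   equals I *)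
Definition is_frechet_integral (R : realType) (M : R) (u : R -> R -> R)
    (f g : R -> R[i]) (I : R[i]) : Prop :=
  forall eps : R, 0 < eps -> exists2 delta : R, 0 < delta &
    forall (m n : nat) (s t xi eta : nat -> R),
      is_partition M m s -> is_partition M n t ->
      is_tagging m s xi -> is_tagging n t eta ->
      mesh m s < delta -> mesh n t < delta ->
      normc (\sum_(i < m) \sum_(j < n) f (xi i) * g (eta j) *
               (rect_incr u (s i) (s i.+1) (t j) (t j.+1))%:C - I) < eps.

(* Main.v *)
(* Write c_N(f, g) = Cov(Tr f(X_N), Tr g(X_N)).  By Cauchy-Schwarz and (iii),
   |c_N(f, g)| <= K sup|f'| sup|g'|.  If f vanishes on [-M, M] then only the event
   ||X_N|| > M contributes: N^4 (E |Tr f|^2)^2 <= C N^8 P(||X_N|| > M) -> 0, so the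
   limit of c_N(f, g) sees only the restrictions to [-M, M].  Extending f affinely
   outside [-M, M] keeps sup|f'| equal to its value on [-M, M], whence
   limsup |c_N(f, g)| <= K ||f'||_M ||g'||_M.  Since polynomials are dense for
   ||f'||_M (Weierstrass, then integrate), c_N(f, g) converges on all of S, and the
   limit defines rho.

   For the integral representation, let u_k(x, y) be the value of the limit form on
   primitives of continuous approximations (ramps of slope k) of the indicators of
   [-M, x] and [-M, y].  Increments of ramps along a partition form a partition of
   unity, so a Riemann sum for u_k is the form evaluated at primitives of functions
   uniformly close to f' and g'.  The bounds are uniform in k, and u is the limit of
   u_k along an ultrafilter. *)

Require Import Defs.
From HB Require Import structures.
From mathcomp Require Import all_boot all_order all_algebra.
From mathcomp Require Import all_classical all_reals all_analysis.
From mathcomp Require Import complex measurable_realfun.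
From mathcomp Require Import ring lra.

Set Implicit Arguments.
Unset Strict Implicit.
Unset Printing Implicit Defensive.

Import Order.TTheory GRing.Theory Num.Theory.
Import numFieldNormedType.Exports.

Local Open Scope classical_set_scope.
Local Open Scope ring_scope.

(** * The complex modulus *)

(** Hypothesis (iii) uses a supremum over the whole line, infinite for every polynomial of degree at
    least 2, while (i) speaks of polynomials only. The two can be combined only on [-M, M], and (ii)
    pays for the passage there. Its exponent 8 is the price of using Cauchy-Schwarz twice. First,
    |Cov|^2 is at most E|Tr f|^2 E|Tr g|^2, whose second factor may grow like N^2. Second, for f
    vanishing on [-M, M], E|Tr f|^2 is at most the square root of P(||X_N|| > M) E|Tr f|^4, where
    the fourth moment may grow like N^4. Altogether |Cov|^2 is of order N^4 P(||X_N|| > M)^(1/2),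
    which tends to 0 as soon as N^8 P(||X_N|| > M) does.

    Measurability of Tr f(X) is obtained without following single eigenvalues: traces of powers are
    measurable, and for continuous f the sum over the eigenvalues is a pointwise limit of
    combinations of such traces.

    The covariance carries no conjugation, so the limit form is complex bilinear and takes real
    values on real functions. This is why u can be real although f and g are complex. *)

Section ComplexNorm.
Variable R : realType.
Local Notation C := R[i].
Implicit Types z w : C.

Lemma Re_add (z w : C) : complex.Re (z + w) = complex.Re z + complex.Re w.
Proof. by case: z w => a b []. Qed.

Lemma Im_add (z w : C) : complex.Im (z + w) = complex.Im z + complex.Im w.
Proof. by case: z w => a b []. Qed.

Lemma Re_sum (I : Type) (r : seq I) (F : I -> C) :
  complex.Re (\sum_(i <- r) F i) = \sum_(i <- r) complex.Re (F i).
Proof. exact: (big_morph _ Re_add). Qed.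

Lemma Im_sum (I : Type) (r : seq I) (F : I -> C) :
  complex.Im (\sum_(i <- r) F i) = \sum_(i <- r) complex.Im (F i).
Proof. exact: (big_morph _ Im_add). Qed.

Lemma normc_sqr (z : C) : normc z ^+ 2 = complex.Re z ^+ 2 + complex.Im z ^+ 2.
Proof. by case: z => a b; rewrite sqr_sqrtr// addr_ge0// sqr_ge0. Qed.

Lemma normc_ge0 (z : C) : 0 <= normc z.
Proof. by case: z => a b; exact: sqrtr_ge0. Qed.

Lemma normcN z : normc (- z) = normc z.
Proof. by case: z => a b /=; rewrite !sqrrN. Qed.

Lemma normcD z w : normc (z + w : C) <= normc z + normc w.
Proof. by have := ler_normD z w; rewrite -lecR rmorphD. Qed.

Lemma normcB z w : normc (z - w : C) <= normc z + normc w.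
Proof. by rewrite (le_trans (normcD _ _))// normcN. Qed.

Lemma normc_sum (I : Type) (r : seq I) (F : I -> C) :
  normc (\sum_(i <- r) F i) <= \sum_(i <- r) normc (F i).
Proof.
elim/big_ind2: _ => [|a b c e ab ce|//]; first by rewrite Normc.normc0.
by rewrite (le_trans (normcD _ _))// lerD.
Qed.

Lemma normc_real (a : R) : normc (a%:C)%C = `|a|.
Proof. by rewrite /= expr0n/= addr0 sqrtr_sqr. Qed.

Lemma normc_le0 z : normc z <= 0 -> z = 0.
Proof. by move=> z0; apply: Normc.eq0_normc; apply/eqP; rewrite eq_le z0 normc_ge0. Qed.

Lemma normc_le_ReIm (z : C) : normc z <= `|complex.Re z| + `|complex.Im z|.
Proof.
rewrite -(@ler_pXn2r _ 2) ?nnegrE ?normc_ge0 ?addr_ge0// normc_sqr sqrrD.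
by rewrite !real_normK ?num_real// -addrA [_ *+ 2 + _]addrC addrA lerDl mulrn_wge0 ?mulr_ge0.
Qed.

Lemma normRe_le (z : C) : `|complex.Re z| <= normc z.
Proof.
rewrite -(@ler_pXn2r _ 2) ?nnegrE ?normc_ge0// normc_sqr real_normK ?num_real//.
by rewrite lerDl sqr_ge0.
Qed.

Lemma normIm_le (z : C) : `|complex.Im z| <= normc z.
Proof.
rewrite -(@ler_pXn2r _ 2) ?nnegrE ?normc_ge0// normc_sqr real_normK ?num_real//.
by rewrite lerDr sqr_ge0.
Qed.

End ComplexNorm.

(** * Eigenvalues of Hermitian matrices *)

Section Eigenvalues.
Variable R : realType.
Local Notation C := R[i].

Definition eig n (A : 'M[C]_n) (k : 'I_n) : R := complex.Re (spectral_diag A 0 k).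

Definition sum_eig n (h : R -> R) (A : 'M[C]_n) : R := \sum_(k < n) h (eig A k).

Lemma Re_trf (f : R -> C) n (A : 'M[C]_n) :
  complex.Re (trf f A) = sum_eig (fun x => complex.Re (f x)) A.
Proof. exact: Re_sum. Qed.

Lemma Im_trf (f : R -> C) n (A : 'M[C]_n) :
  complex.Im (trf f A) = sum_eig (fun x => complex.Im (f x)) A.
Proof. exact: Im_sum. Qed.

Lemma spectral_diagE n (A : 'M[C]_n) k : A \is hermsymmx ->
  spectral_diag A 0 k = (eig A k)%:C%C.
Proof.
move=> /hermitian_spectral_diag_real/mxOverP/(_ 0 k).
by rewrite /eig; case: (spectral_diag A 0 k) => a b; rewrite complex_real => /= /eqP ->.
Qed.

Lemma expmx_conj n (U D : 'M[C]_n) m : U \in unitmx ->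
  (invmx U *m D *m U) ^+ m = invmx U *m D ^+ m *m U.
Proof.
move=> uU; have expS (B : 'M[C]_n) k : B ^+ k.+1 = B *m B ^+ k by exact: exprS.
elim: m => [|m IH]; first by rewrite !expr0 mulmx1 mulVmx.
by rewrite !expS IH -!mulmxA (mulKVmx uU).
Qed.

Lemma expmx_diag n (s : 'rV[C]_n) m :
  diag_mx s ^+ m = diag_mx (map_mx (fun x => x ^+ m) s).
Proof.
have expS (B : 'M[C]_n) k : B ^+ k.+1 = B *m B ^+ k by exact: exprS.
elim: m => [|m IH]; last first.
  by rewrite expS IH mulmx_diag; congr diag_mx; apply/rowP => j; rewrite !mxE exprS.
by rewrite expr0; apply/matrixP => i j; rewrite !mxE.
Qed.

(** Cyclicity of the trace removes the unitary change of basis. This is the bridge from the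
    hypotheses, stated with traces of matrix powers, to the sums over eigenvalues used below. *)
Lemma tr_expmx n (A : 'M[C]_n) m : A \is hermsymmx ->
  \tr (A ^+ m) = (sum_eig (fun x => x ^+ m) A)%:C%C.
Proof.
move=> hA; have /hermitian_normalmx/orthomx_spectralP eA := hA.
rewrite {1}eA expmx_conj ?spectral_unit// expmx_diag mxtrace_mulC.
rewrite (mulKVmx (spectral_unit A)) mxtrace_diag /sum_eig rmorph_sum/=.
by apply: eq_bigr => k _; rewrite mxE spectral_diagE// rmorphXn.
Qed.

Local Open Scope sesquilinear_scope.

Lemma l2norm_sqr n (v : 'cV[C]_n) :
  ((l2norm v ^+ 2)%:C)%C = (v ^t* *m v) 0 0.
Proof.
rewrite /l2norm sqr_sqrtr ?sumr_ge0// => [|i _]; last exact: sqr_ge0.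
rewrite rmorph_sum/= mxE; apply: eq_bigr => i _; rewrite !mxE rmorphXn/=.
by rewrite mulrC -normCK.
Qed.

Lemma l2norm_ge0 n (v : 'cV[C]_n) : 0 <= l2norm v.
Proof. exact: sqrtr_ge0. Qed.

Lemma l2norm_unitary n (U : 'M[C]_n) (v : 'cV[C]_n) : U \is unitarymx ->
  l2norm (U *m v) = l2norm v.
Proof.
move=> uU; have UU : U ^t* *m U = 1%:M.
  by move: uU; rewrite -trmxC_unitary => /unitarymxP; rewrite trmxCK.
apply/eqP; rewrite -(@eqrXn2 _ 2) ?l2norm_ge0//; apply/eqP/complexI.
by rewrite !l2norm_sqr trmx_mul map_mxM mulmxA -(mulmxA (v ^t*)) UU mulmx1.
Qed.

Lemma l2norm_conj n (U D : 'M[C]_n) (v : 'cV[C]_n) : U \is unitarymx ->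
  l2norm (invmx U *m D *m U *m v) = l2norm (D *m (U *m v)).
Proof.
move=> uU; have uU' : U ^t* \is unitarymx by rewrite trmxC_unitary.
rewrite (invmx_unitary uU) -(mulmxA _ U v) -(mulmxA (U ^t*)).
exact: l2norm_unitary.
Qed.

Lemma l2norm_diag_le n (s : 'rV[C]_n) (v : 'cV[C]_n) (M : R) :
  0 <= M -> (forall k, normc (s 0 k) <= M) ->
  l2norm (diag_mx s *m v) <= M * l2norm v.
Proof.
move=> M0 sM; rewrite -(@ler_pXn2r _ 2) ?nnegrE ?mulr_ge0 ?l2norm_ge0// exprMn.
rewrite /l2norm !sqr_sqrtr ?sumr_ge0// => [|i _|i _]; try exact: sqr_ge0.
rewrite mulr_sumr; apply: ler_sum => i _; rewrite mul_diag_mx mxE Normc.normcM exprMn.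
rewrite ler_wpM2r ?sqr_ge0// ler_pXn2r ?nnegrE//.
by case: (s 0 i) => a b; rewrite sqrtr_ge0.
Qed.

(** Turns the event of the tail hypothesis into a condition on eigenvalues. Unitary matrices
    preserve [l2norm], so only the diagonal form of [A] matters. *)
Lemma opnorm_gtP n (A : 'M[C]_n) (M : R) : A \is hermsymmx -> 0 <= M ->
  M < opnorm A <-> exists k, M < `|eig A k|.
Proof.
move=> hA M0; have /hermitian_normalmx/orthomx_spectralP := hA.
set U := spectralmx A; set s := spectral_diag A => eA.
have uU : U \is unitarymx by exact: spectral_unitarymx.
have ns k : normc (s 0 k) = `|eig A k|.
  by rewrite spectral_diagE//= expr0n/= addr0 sqrtr_sqr.
have nA v : l2norm (A *m v) = l2norm (diag_mx s *m (U *m v)).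
  by rewrite {1}eA l2norm_conj.
have bA L v : 0 <= L -> (forall k, `|eig A k| <= L) -> l2norm v <= 1 ->
    l2norm (A *m v) <= L.
  move=> L0 kL v1; rewrite nA (le_trans (l2norm_diag_le _ L0 _))//.
    by move=> k; rewrite ns.
  by rewrite l2norm_unitary// ler_piMr.
set S := [set l2norm (A *m v) | v in [set v | l2norm v <= 1]].
have l2norm0 : l2norm (0 : 'cV[C]_n) = 0.
  by rewrite /l2norm big1 ?sqrtr0// => i _; rewrite mxE Normc.normc0 expr0n.
have S0 : S !=set0.
  exists (l2norm (A *m (0 : 'cV_n))).
  by apply: (imageP (fun v : 'cV_n => l2norm (A *m v))); rewrite /mkset l2norm0.
split=> [MA|[k Mk]].
  apply: contrapT => /forallNP nk; move: MA; rewrite ltNge => /negP; apply.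
  rewrite /opnorm -/S; apply: ge_sup => // _ [v /= v1 <-].
  by apply: bA => // k; rewrite leNgt; apply/negP.
apply: (lt_le_trans Mk); rewrite /opnorm -/S; apply: ub_le_sup.
  (* A crude upper bound: the set has to be bounded before its elements can be compared with its
     supremum. *)
  exists (\sum_k `|eig A k|) => _ [v /= v1 <-]; apply: bA => //.
    by apply: sumr_ge0.
  by move=> j; rewrite (bigD1 j)//= lerDl sumr_ge0.
have l2d a : l2norm (a *: delta_mx k 0 : 'cV[C]_n) = normc a.
  rewrite /l2norm (bigD1 k)//= big1 ?addr0.
    rewrite !mxE !eqxx mulr1 sqrtr_sqr ger0_norm//.
    by case: (a) => x y; rewrite sqrtr_ge0.
  by move=> i ik; rewrite !mxE (negbTE ik) mulr0 Normc.normc0 expr0n.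
(* A unit eigenvector for [eig A k]: the column of index [k] of the inverse of [U]. *)
exists (U ^t* *m delta_mx k 0) => /=.
  by rewrite l2norm_unitary ?trmxC_unitary// -[delta_mx _ _]scale1r l2d Normc.normc1.
rewrite nA mulmxA; move/unitarymxP: (uU) => ->; rewrite mul1mx -ns -l2d.
by congr l2norm; apply/colP => i; rewrite mul_diag_mx !mxE; case: eqP => [->|]; rewrite ?mulr0//.
Qed.

End Eigenvalues.

(** * Weierstrass approximation *)

Section RandomWalk.
Variable R : realFieldType.

(* Expectation of [phi S_n] for a random walk [S_n] with Bernoulli(x) steps. *)
Fixpoint walk (n : nat) (phi : nat -> R) (x : R) : R :=
  if n is m.+1 then (1 - x) * walk m phi x + x * walk m (fun k => phi k.+1) x
  else phi 0%N.

(** For [phi k = f (k / n)] this is the Bernstein polynomial of [f]; conditioning on the first step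
    of the walk avoids binomial coefficients. *)
Fixpoint walk_poly (n : nat) (phi : nat -> R) : {poly R} :=
  if n is m.+1 then
    (1 - 'X) * walk_poly m phi + 'X * walk_poly m (fun k => phi k.+1)
  else (phi 0%N)%:P.

Lemma horner_walk_poly n phi x : (walk_poly n phi).[x] = walk n phi x.
Proof.
elim: n phi => [|n IH] phi /=; first by rewrite hornerC.
by rewrite !hornerE !IH.
Qed.

Lemma walk_linear n a phi psi x :
  walk n (fun k => a * phi k + psi k) x = a * walk n phi x + walk n psi x.
Proof. by elim: n phi psi => //= n IH phi psi; rewrite !IH; ring. Qed.

Lemma le_walk n phi psi x : 0 <= x <= 1 ->
  (forall k, (k <= n)%N -> phi k <= psi k) -> walk n phi x <= walk n psi x.
Proof.
move=> /andP[x0 x1]; elim: n phi psi => [|n IH] phi psi /= le; first exact: le.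
rewrite lerD// ler_wpM2l ?subr_ge0// IH// => k kn; apply: le => //.
exact: leqW.
Qed.

Lemma walk_cst n c x : walk n (fun=> c) x = c.
Proof. by elim: n => //= n ->; ring. Qed.

(** Variance plus squared bias of a binomial variable. The centre [c] is arbitrary so that the
    induction can absorb the shift by one step; at [c = n x] only the variance is left. *)
Lemma walk_sqr n c x :
  walk n (fun k => (k%:R - c) ^+ 2) x = n%:R * (x * (1 - x)) + (n%:R * x - c) ^+ 2.
Proof.
elim: n c => [|n IH] c /=; first by ring.
have -> : walk n (fun k => (k.+1%:R - c) ^+ 2) x =
          walk n (fun k => (k%:R - (c - 1)) ^+ 2) x.
  by congr (walk n _ x); apply/funext => k; rewrite -natr1; congr (_ ^+ 2); ring.
by rewrite !IH -natr1; ring.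
Qed.

End RandomWalk.

Section Weierstrass.
Variable R : realType.

(** Heine-Cantor through the covering form of compactness: at each point of the segment, a ball of
    half the local modulus serves all its members. Only [x] is confined to the segment. *)
Lemma continuous_unif_seg (f : R -> R) (a b e : R) : continuous f -> 0 < e ->
  exists2 d : R, 0 < d & forall x y, a <= x <= b -> `|x - y| < d ->
    `|f x - f y| < e.
Proof.
move=> cf e0.
have /compact_near_coveringP/(_ _ (0^'+)
    (fun d x => forall y, `|x - y| < d -> `|f x - f y| < e) _) := @segment_compact _ a b.
case.
  move=> x _; have /cvgrPdist_lt/(_ _ (divr_gt0 e0 (ltr0Sn _ 1))) := cf x.
  move=> /nbhs_ballP[d /= d0 fd].
  exists (ball x (d / 2), [set t | t < d / 2]) => /=.
    split; first exact: nbhsx_ballx (divr_gt0 d0 _).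
    exact: nbhs_right_lt (divr_gt0 d0 _).
  move=> [z t]/= [xz td] y zy.
  have fz : `|f x - f z| < e / 2.
    by apply: fd; apply: le_ball xz; lra.
  have fy : `|f x - f y| < e / 2.
    apply: fd; rewrite /ball/= -(subrK z x) -addrA (le_lt_trans (ler_normD _ _))//.
    by rewrite [ltRHS](splitr d) ltrD// (lt_trans zy).
  rewrite (splitr e) -(subrK (f x) (f z)) -addrA (le_lt_trans (ler_normD _ _))//.
  by rewrite ltrD// distrC.
move=> d /= d0 dP; exists (d / 2); first by rewrite divr_gt0.
move=> x y xab xy; apply: (dP (d / 2)) => //=; rewrite ?in_itv ?divr_gt0//.
by rewrite sub0r normrN gtr0_norm ?divr_gt0// ltr_pdivrMr// ltr_pMr// ltr1n.
Qed.

Lemma continuous_bounded_seg (f : R -> R) (a b : R) : continuous f ->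
  exists2 c : R, 0 < c & forall x, a <= x <= b -> `|f x| <= c.
Proof.
move=> cf; have /compact_bounded[c [_ /(_ (`|c| + 1)) fc]] :
    compact (f @` `[a, b]).
  apply: continuous_compact (@segment_compact _ a b) => //.
  exact: continuous_subspaceT.
exists (`|c| + 1); first by rewrite ltr_wpDl.
move=> x xab; apply: fc; first by rewrite (le_lt_trans (ler_norm _))// ltrDl.
by exists x => //=; rewrite in_itv.
Qed.

(** Bernstein's proof: the law of large numbers concentrates [k / N] near [x], with Chebyshev's
    inequality in place of exact binomial estimates. *)
Lemma weierstrass01 (f : R -> R) (e : R) : continuous f -> 0 < e ->
  exists p : {poly R}, forall x, 0 <= x <= 1 -> `|f x - p.[x]| <= e.
Proof.
move=> cf e0.
have [d d0 fd] := @continuous_unif_seg f 0 1 (e / 2) cf (divr_gt0 e0 (ltr0Sn _ 1)).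
have [c c0 fc] := @continuous_bounded_seg f 0 1 cf.
(* If [k / N] is at distance at least [d] from [x], then [2 * c <= D * (k / N - x)^2]. One bound,
   [e / 2] plus this quadratic term, therefore serves for near and far [k] alike. *)
pose D := 2 * c / d ^+ 2.
have D0 : 0 < D by rewrite divr_gt0 ?mulr_gt0 ?exprn_gt0.
have [n nD] : exists n : nat, 2 * D / e <= n.+1%:R.
  by exists (Num.truncn (2 * D / e)); apply: ltW; rewrite truncnS_gt.
set N := n.+1 in nD; have N0 : (0 : R) < N%:R by rewrite ltr0n.
pose phi k := f (k%:R / N%:R).
exists (walk_poly N phi) => x x01; rewrite horner_walk_poly.
have x0 : 0 <= x by case/andP: x01.
have x1 : x <= 1 by case/andP: x01.
pose q k := (k%:R - N%:R * x) ^+ 2.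
have dev k : (k <= N)%N -> `|phi k - f x| <= e / 2 + D / N%:R ^+ 2 * q k.
  move=> kN; have k01 : 0 <= (k%:R / N%:R : R) <= 1.
    by rewrite divr_ge0//= ler_pdivrMr// mul1r ler_nat.
  have [xd|xd] := ltP `|k%:R / N%:R - x| d.
    rewrite (le_trans (ltW (fd _ _ k01 xd)))// lerDl mulr_ge0 ?sqr_ge0//.
    by rewrite divr_ge0 ?exprn_ge0// ltW.
  rewrite (@le_trans _ _ (2 * c))//.
    by rewrite (le_trans (ler_normB _ _))// mulr_natl mulr2n lerD ?fc.
  rewrite (_ : D / _ * _ = 2 * c * ((k%:R / N%:R - x) / d) ^+ 2); last first.
    rewrite /D /q; field; rewrite ?lt0r_neq0//.
  rewrite (@le_trans _ _ (2 * c * 1))//; first by rewrite mulr1.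
  have : 1 <= ((k%:R / N%:R - x) / d) ^+ 2.
    rewrite -(@ger0_norm _ (_ ^+ 2)) ?sqr_ge0// normrX.
    by rewrite exprn_ege1// normrM normfV (gtr0_norm d0) ler_pdivlMr ?mul1r.
  move=> h; rewrite (@le_trans _ _ (2 * c * ((k%:R / N%:R - x) / d) ^+ 2))//.
    by rewrite ler_wpM2l// mulr_ge0// ltW.
  by rewrite lerDr divr_ge0// ltW.
have wq : walk N (fun k => D / N%:R ^+ 2 * q k + e / 2) x <= e.
  rewrite walk_linear walk_cst walk_sqr subrr expr0n/= addr0.
  rewrite [leRHS](splitr e) lerD2r.
  have -> : D / N%:R ^+ 2 * (N%:R * (x * (1 - x))) = D / N%:R * (x * (1 - x)).
    by field; rewrite lt0r_neq0.
  have : D / N%:R <= e / 2.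
    rewrite ler_pdivrMr//; move: nD; rewrite ler_pdivrMr// => nD; nra.
  have : 0 <= D / N%:R by rewrite divr_ge0// ltW.
  have : x * (1 - x) <= 1 by nra.
  have : 0 <= x * (1 - x) by nra.
  nra.
have fE : walk N phi x - f x = walk N (fun k => 1 * phi k + (- f x)) x.
  by rewrite walk_linear walk_cst mul1r.
rewrite distrC fE ler_norml; apply/andP; split; last first.
  apply: le_trans wq; apply: le_walk => // k kN; have := dev k kN.
  by rewrite ler_norml => /andP[_]; lra.
(* The lower estimate compares with the negated majorant, written as [-1 * _ + 0] to fit
   [walk_linear]. *)
have := @le_walk _ N (fun k => -1 * (D / N%:R ^+ 2 * q k + e / 2) + 0)
   (fun k => 1 * phi k - f x) x x01.
rewrite (walk_linear _ (-1)) walk_cst => le; rewrite (le_trans _ (le _))//.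
  lra.
move=> k kN; have := dev k kN; rewrite ler_norml => /andP[+ _]; lra.
Qed.

Lemma weierstrass (f : R -> R) (M e : R) : continuous f -> 0 < M -> 0 < e ->
  exists p : {poly R}, forall x, - M <= x <= M -> `|f x - p.[x]| <= e.
Proof.
move=> cf M0 e0.
have cg : continuous (fun t : R => f ((2 * t - 1) * M)).
  move=> t; apply: (@continuous_comp _ _ _ (fun t : R => (2 * t - 1) * M) f); last exact: cf.
  apply: cvgM; last exact: cvg_cst.
  by apply: cvgB; [apply: cvgM; [exact: cvg_cst|exact: cvg_id]|exact: cvg_cst].
have [p hp] := weierstrass01 cg e0.
exists (p \Po ((2^-1)%:P * ((M^-1)%:P * 'X + 1%:P))) => x /andP[xl xr].
rewrite horner_comp !hornerE; set t := (X in p.[X]).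
have -> : f x = f ((2 * t - 1) * M).
  by congr f; rewrite /t; field; rewrite ?lt0r_neq0.
apply: hp; rewrite /t; apply/andP; split.
  by rewrite mulr_ge0// -lerBlDr sub0r mulrC ler_pdivlMr// mulN1r.
rewrite ler_pdivrMl// mulr1 -lerBrDr mulrC ler_pdivrMr//; lra.
Qed.

End Weierstrass.

(** * Affine extension of C1 functions *)

Section C1functions.
Variable R : realType.
Local Notation C := R[i].
Implicit Types f g : R -> R.

(** The derivative is explicit data, so that each construction below delivers it together with the
    function. *)
Definition C1_with f f' := (forall x : R, is_derive x 1 f (f' x)) /\ continuous f'.

Definition splice (a : R) f g := fun x => if x <= a then f x else g x.

Lemma continuous_at_splice a f g : f a = g a -> {for a, continuous f} ->
  {for a, continuous g} -> {for a, continuous (splice a f g)}.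
Proof.
move=> fga cf cg; apply/cvgrPdist_lt => e e0.
move/cvgrPdist_lt : cf => /(_ e e0) cf; move/cvgrPdist_lt : cg => /(_ e e0) cg.
near=> x; rewrite {1}/splice lexx /splice; case: ifPn => _; first by near: x.
by rewrite fga; near: x.
Unshelve. all: by end_near. Qed.

Lemma near_splice_lt a f g x : x < a -> \forall y \near x, splice a f g y = f y.
Proof.
move=> xa; near=> y; rewrite /splice ifT//; apply/ltW; near: y.
exact: lt_nbhsl.
Unshelve. all: by end_near. Qed.

Lemma near_splice_gt a f g x : a < x -> \forall y \near x, splice a f g y = g y.
Proof.
move=> xa; near=> y; rewrite /splice ifF//; apply/negbTE; rewrite -ltNge; near: y.
exact: lt_nbhsr.
Unshelve. all: by end_near. Qed.

Lemma continuous_splice a f g : f a = g a -> continuous f -> continuous g ->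
  continuous (splice a f g).
Proof.
move=> fga cf cg x; have [xa|ax|->] := ltgtP x a.
3: exact: (continuous_at_splice fga (cf a) (cg a)).
- rewrite /continuous_at [splice a f g x]/splice (ltW xa).
  apply: cvg_trans (cf x); apply: near_eq_cvg.
  by near=> y; apply/esym; near: y; exact: near_splice_lt.
- rewrite /continuous_at [splice a f g x]/splice leNgt ax/=.
  apply: cvg_trans (cg x); apply: near_eq_cvg.
  by near=> y; apply/esym; near: y; exact: near_splice_gt.
Unshelve. all: by end_near. Qed.

Lemma C1_splice a f g f' g' : C1_with f f' -> C1_with g g' -> f a = g a ->
  f' a = g' a -> C1_with (splice a f g) (splice a f' g').
Proof.
move=> [df cf] [dg cg] fga fga'; split; last exact: continuous_splice.
move=> x; have [xa|ax|->] := ltgtP x a.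
- rewrite [splice a f' g' x]/splice (ltW xa); apply: (near_eq_is_derive _ (df x)).
  by near=> y; apply/esym; near: y; exact: near_splice_lt.
- rewrite [splice a f' g' x]/splice leNgt ax/=; apply: (near_eq_is_derive _ (dg x)).
  by near=> y; apply/esym; near: y; exact: near_splice_gt.
(* At the junction the Caratheodory slopes of [f] and [g] are spliced in turn: both take the value
   [f' a = g' a] there, so the spliced slope is continuous at [a]. *)
have /is_derive1_caratheodory[F [fF cF Fa]] := df a.
have /is_derive1_caratheodory[G [gG cG Ga]] := dg a.
apply/is_derive1_caratheodory; exists (splice a F G); split.
- by move=> z; rewrite /splice lexx; case: ifP => _; [exact: fF|rewrite fga; exact: gG].
- by apply: (continuous_at_splice _ cF cG); rewrite Fa Ga.
- by rewrite /splice lexx.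
Unshelve. all: by end_near. Qed.

Definition tangent f f' (a : R) := fun x => f a + f' a * (x - a).

Lemma C1_tangent f f' a : C1_with (tangent f f' a) (fun=> f' a).
Proof.
split; last by move=> x; exact: cvg_cst.
move=> x; rewrite /tangent; apply: is_derive_eq; rewrite /GRing.scale/=; ring.
Qed.

Definition lin_ext (M : R) f f' :=
  splice M (splice (- M) (tangent f f' (- M)) f) (tangent f f' M).

(** The projection onto [[-M, M]]: the affine extension has at [x] the derivative of [f] at the
    projected point. *)
Definition clamp (M x : R) := if x <= - M then - M else if x <= M then x else M.

Lemma clamp_in M x : 0 <= M -> - M <= clamp M x <= M.
Proof.
move=> M0; rewrite /clamp; case: ifPn => [_|]; last case: ifPn => [xM|_ _]; rewrite ?lexx.
- by lra.
- by rewrite -ltNge => /ltW ->.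
- by lra.
Qed.

Lemma clamp_id M x : - M <= x <= M -> clamp M x = x.
Proof.
move=> /andP[Mx xM]; rewrite /clamp xM; case: ifPn => // xM'.
by apply/eqP; rewrite eq_le Mx.
Qed.

Lemma lin_extE M f f' x : - M <= x <= M -> lin_ext M f f' x = f x.
Proof.
move=> /andP[Mx xM]; rewrite /lin_ext /splice xM; case: ifPn => // xM'.
have -> : x = - M by apply/eqP; rewrite eq_le xM'.
by rewrite /tangent subrr mulr0 addr0.
Qed.

Lemma C1_lin_ext M f f' : 0 < M -> C1_with f f' ->
  C1_with (lin_ext M f f') (fun x => f' (clamp M x)).
Proof.
move=> M0 ff'; have -> : (fun x => f' (clamp M x)) =
    splice M (splice (- M) (fun=> f' (- M)) f') (fun=> f' M).
  apply/funext => x; rewrite /splice /clamp; case: ifPn => [xM|_]; last by case: ifPn.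
  by have -> : x <= M by lra.
apply: C1_splice; first apply: C1_splice => //; try exact: C1_tangent.
- by rewrite /tangent subrr mulr0 addr0.
- by rewrite /splice /tangent ifF ?subrr ?mulr0 ?addr0//; apply/negbTE; rewrite -ltNge; lra.
- by rewrite /splice ifF//; apply/negbTE; rewrite -ltNge; lra.
Qed.

End C1functions.

(** * Complex covariances *)

Section L2.
Context d (T : measurableType d) (R : realType) (P : probability T R).
Local Notation C := R[i].
Implicit Types (X Y : T -> R) (Z W : T -> C).

Local Notation E X := (Rintegral P setT X).
Local Notation integ X := (P.-integrable setT (EFin \o X)).

Lemma integ_cst (c : R) : integ (fun=> c).
Proof. exact: finite_measure_integrable_cst. Qed.

Lemma integ_meas X : integ X -> measurable_fun setT X.
Proof. by move=> /measurable_int/measurable_EFinP. Qed.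

Lemma integD X Y : integ X -> integ Y -> integ (fun w => X w + Y w).
Proof. by move=> iX iY; apply: eq_integrable (integrableD _ iX iY). Qed.

Lemma integZ (a : R) X : integ X -> integ (fun w => a * X w).
Proof. by move=> iX; apply: eq_integrable (integrableZl _ a iX). Qed.

Lemma integB X Y : integ X -> integ Y -> integ (fun w => X w - Y w).
Proof. by move=> iX iY; apply: eq_integrable (integrableB _ iX iY). Qed.

Lemma integ_le X Y : measurable_fun setT X -> integ Y ->
  (forall w, `|X w| <= Y w) -> integ X.
Proof.
move=> mX iY le; apply: le_integrable iY => //; first exact/measurable_EFinP.
by move=> w _ /=; rewrite lee_fin (le_trans (le w))// ler_norm.
Qed.

Lemma meanD X Y : integ X -> integ Y -> E (fun w => X w + Y w) = E X + E Y.
Proof. by move=> *; rewrite RintegralD. Qed.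

Lemma meanZ a X : integ X -> E (fun w => a * X w) = a * E X.
Proof. by move=> *; rewrite RintegralZl. Qed.

Lemma mean_cst c : E (fun=> c) = c.
Proof.
rewrite Rintegral_cst//; have := probability_setT P => /= ->; exact: mulr1.
Qed.

Lemma mean_le X Y : integ X -> integ Y -> (forall w, X w <= Y w) -> E X <= E Y.
Proof. by move=> iX iY le; apply: le_Rintegral. Qed.

Definition L2 X := measurable_fun setT X /\ integ (fun w => X w ^+ 2).

Lemma L2_mul X Y : L2 X -> L2 Y -> integ (fun w => X w * Y w).
Proof.
move=> [mX iX] [mY iY]; apply: integ_le (integD iX iY) _.
  exact: measurable_funM.
move=> w; rewrite normrM -(real_normK (num_real (X w))) -(real_normK (num_real (Y w))).
have := sqr_ge0 (`|X w| - `|Y w|); have := normr_ge0 (X w); have := normr_ge0 (Y w).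
by nra.
Qed.

Lemma L2_cst c : L2 (fun=> c).
Proof. by split; [exact: measurable_cst|exact: integ_cst]. Qed.

Lemma L2_integ X : L2 X -> integ X.
Proof.
move=> lX; apply: eq_integrable (L2_mul (L2_cst 1) lX) => // w _.
by rewrite /= mul1r.
Qed.

Lemma L2D X Y : L2 X -> L2 Y -> L2 (fun w => X w + Y w).
Proof.
move=> lX lY; split; first exact: measurable_funD lX.1 lY.1.
apply: (eq_integrable _ _ _ _ (integD lX.2 (integD (integZ 2 (L2_mul lX lY)) lY.2))) => // w _.
by rewrite /=; congr EFin; ring.
Qed.

(* The hypothesis is what expanding [0 <= E (t X - s Y)^2] gives, with [S = s^2]. *)
Lemma le_of_quadratic (S A B : R) : 0 <= A -> 0 <= B -> 0 <= S ->
  (forall t, 0 <= t -> 2 * t * S <= t ^+ 2 * A + S * B) -> S <= A * B.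
Proof.
move=> A0 B0 S0 h; have [B00|B00] := eqVneq B 0.
  rewrite B00 mulr0 leNgt; apply/negP => Spos.
  have A1 : 0 < A + 1 by lra.
  (* For [B = 0] and this [t] the hypothesis reads [2 t^2 (A + 1) <= t^2 A], impossible for [t > 0].
     For [B > 0], below, [t = B] gives the claim after cancelling a factor [B]. *)
  have t0 : 0 < S / (A + 1) by rewrite divr_gt0.
  have := h _ (ltW t0); rewrite B00 mulr0 addr0; set t := _ / _ in t0 *.
  have -> : S = t * (A + 1) by rewrite /t divfK// lt0r_neq0.
  have tt : 0 < t ^+ 2 by rewrite exprn_gt0.
  have ttA : 0 <= t ^+ 2 * A by rewrite mulr_ge0// ltW.
  move=> le; suff: t ^+ 2 * (A + 2) <= 0 by rewrite pmulr_rle0//; lra.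
  by move: le; lra.
have B1 : 0 < B by rewrite lt0r B00.
have := h B B0; move=> le; rewrite -(ler_pM2l B1); lra.
Qed.

Lemma mean_sqr_ge0 X : 0 <= E (fun w => X w ^+ 2).
Proof. by apply: Rintegral_ge0 => w _; exact: sqr_ge0. Qed.

Lemma cauchy_schwarz X Y : L2 X -> L2 Y ->
  E (fun w => X w * Y w) ^+ 2 <= E (fun w => X w ^+ 2) * E (fun w => Y w ^+ 2).
Proof.
move=> lX lY; set s := E _; apply: le_of_quadratic; rewrite ?mean_sqr_ge0 ?sqr_ge0//.
move=> t t0; have iXY := L2_mul lX lY.
have := mean_sqr_ge0 (fun w => t * X w - s * Y w).
have -> : E (fun w => (t * X w - s * Y w) ^+ 2) =
    E (fun w => t ^+ 2 * X w ^+ 2 + (s ^+ 2 * Y w ^+ 2 + - (2 * t * s) * (X w * Y w))).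
  by apply: eq_Rintegral => w _; ring.
have iX := integZ (t ^+ 2) lX.2; have iY := integZ (s ^+ 2) lY.2.
have iC := integZ (- (2 * t * s)) iXY; have iYC := integD iY iC.
rewrite (meanD iX iYC) (meanD iY iC) (meanZ _ lX.2) (meanZ _ lY.2) (meanZ _ iXY).
by rewrite -/s; lra.
Qed.

Definition cL2 Z := L2 (fun w => complex.Re (Z w)) /\ L2 (fun w => complex.Im (Z w)).

Lemma cexpectationE Z : cexpectation P Z =
  (E (fun w => complex.Re (Z w)) +i* E (fun w => complex.Im (Z w)))%C.
Proof. by rewrite /cexpectation unlock. Qed.

Definition real_cvariance Z := E (fun w => normc (Z w - cexpectation P Z) ^+ 2).

Lemma cL2_cst (c : C) : cL2 (fun=> c).
Proof. by split; exact: L2_cst. Qed.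

Lemma cL2D Z W : cL2 Z -> cL2 W -> cL2 (fun w => Z w + W w).
Proof.
move=> [rZ iZ] [rW iW]; split.
  by under eq_fun do rewrite Re_add; exact: L2D.
by under eq_fun do rewrite Im_add; exact: L2D.
Qed.

Lemma cL2_cintegrable Z : cL2 Z -> cintegrable P Z.
Proof. by move=> [rZ iZ]; split; exact: L2_integ. Qed.

Lemma cL2_mul Z W : cL2 Z -> cL2 W -> cintegrable P (fun w => Z w * W w).
Proof.
move=> [rZ iZ] [rW iW]; split.
- apply: (eq_integrable _ _ _ _ (integB (L2_mul rZ rW) (L2_mul iZ iW))) => // w _.
  by congr EFin; case: (Z w) (W w) => a b [].
- apply: (eq_integrable _ _ _ _ (integD (L2_mul rZ iW) (L2_mul iZ rW))) => // w _.
  by congr EFin; case: (Z w) (W w) => a b [].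
Qed.

Lemma cexpectation_cst (c : C) : cexpectation P (fun=> c) = c.
Proof. by rewrite cexpectationE !mean_cst; case: c. Qed.

Lemma cexpectation_lin (a : C) Z W : cintegrable P Z -> cintegrable P W ->
  cexpectation P (fun w => a * Z w + W w) = a * cexpectation P Z + cexpectation P W.
Proof.
move=> [rZ iZ] [rW iW]; rewrite !cexpectationE.
have -> : (fun w => complex.Re (a * Z w + W w)) = fun w =>
    complex.Re a * complex.Re (Z w) + (- complex.Im a * complex.Im (Z w) + complex.Re (W w)).
  by apply/funext => w; case: a (Z w) (W w) => a b [x y] [p q] /=; ring.
have -> : (fun w => complex.Im (a * Z w + W w)) = fun w =>
    complex.Re a * complex.Im (Z w) + (complex.Im a * complex.Re (Z w) + complex.Im (W w)).
  by apply/funext => w; case: a (Z w) (W w) => a b [x y] [p q] /=; ring.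
rewrite !(meanD, meanZ)//; do ?[exact: integZ|apply: integD => //; exact: integZ].
by case: a => a b; apply/eqP; rewrite eq_complex /=; apply/andP; split; apply/eqP; ring.
Qed.

Lemma ccovarianceC Z W : ccovariance P Z W = ccovariance P W Z.
Proof.
rewrite /ccovariance mulrC; congr (cexpectation P _ - _).
by apply/funext => w; exact: mulrC.
Qed.

Lemma ccovariance_linl (a : C) Z1 Z2 W : cL2 Z1 -> cL2 Z2 -> cL2 W ->
  ccovariance P (fun w => a * Z1 w + Z2 w) W =
  a * ccovariance P Z1 W + ccovariance P Z2 W.
Proof.
move=> l1 l2 lW; rewrite /ccovariance cexpectation_lin; try exact: cL2_cintegrable.
have -> : (fun w => (a * Z1 w + Z2 w) * W w) =
    (fun w => a * (Z1 w * W w) + Z2 w * W w).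
  by apply/funext => w; ring.
by rewrite cexpectation_lin; [ring|exact: cL2_mul|exact: cL2_mul].
Qed.

Lemma ccovariance_cst (c : C) Z : cL2 Z -> ccovariance P (fun=> c) Z = 0.
Proof.
move=> lZ; rewrite /ccovariance cexpectation_cst.
have -> : (fun w => c * Z w) = (fun w => c * Z w + 0) by apply/funext => w; rewrite addr0.
rewrite cexpectation_lin; [|exact: cL2_cintegrable|exact: cL2_cintegrable (cL2_cst 0)].
by rewrite cexpectation_cst addr0 subrr.
Qed.

Lemma integ_normc2 Z : cL2 Z -> integ (fun w => normc (Z w) ^+ 2).
Proof.
move=> [rZ iZ]; apply: (eq_integrable _ _ _ _ (integD rZ.2 iZ.2)) => // w _.
by rewrite /= normc_sqr.
Qed.

Lemma cL2_sub_cst Z c : cL2 Z -> cL2 (fun w => Z w - c).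
Proof. by move=> lZ; exact: cL2D lZ (cL2_cst (- c)). Qed.

Lemma cvarianceE Z : cL2 Z -> cvariance P Z = (real_cvariance Z)%:E.
Proof.
move=> lZ; rewrite /cvariance /real_cvariance unlock /Rintegral fineK//.
by apply: integrable_fin_num => //; exact: integ_normc2 (cL2_sub_cst _ lZ).
Qed.

Lemma real_cvariance_ge0 Z : 0 <= real_cvariance Z.
Proof. exact: mean_sqr_ge0. Qed.

Lemma real_cvariance_le Z : cL2 Z -> real_cvariance Z <= E (fun w => normc (Z w) ^+ 2).
Proof.
move=> lZ; have [rZ iZ] := lZ; rewrite /real_cvariance cexpectationE.
pose a := E (fun w => complex.Re (Z w)); pose b := E (fun w => complex.Im (Z w)).
rewrite -/a -/b.
have -> : E (fun w => normc (Z w - (a +i* b)%C) ^+ 2) =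
  E (fun w => normc (Z w) ^+ 2 + ((- (2 * a)) * complex.Re (Z w) +
    ((- (2 * b)) * complex.Im (Z w) + (a ^+ 2 + b ^+ 2)))).
  apply: eq_Rintegral => w _; rewrite !normc_sqr; case: (Z w) => x y /=; ring.
have iR := L2_integ rZ; have iI := L2_integ iZ; have iN := integ_normc2 lZ.
have ic := integ_cst (a ^+ 2 + b ^+ 2).
have iIc := integD (integZ (- (2 * b)) iI) ic.
rewrite meanD//; last exact: integD (integZ _ iR) iIc.
rewrite meanD//; last exact: integZ.
rewrite meanD//; last exact: integZ.
rewrite !meanZ// mean_cst -/a -/b; have := sqr_ge0 a; have := sqr_ge0 b; lra.
Qed.

Lemma cexpectation_center Z : cL2 Z ->
  cexpectation P (fun w => Z w - cexpectation P Z) = 0.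
Proof.
move=> lZ; under eq_fun do rewrite -[Z _]mul1r.
rewrite cexpectation_lin; [|exact: cL2_cintegrable|exact: cL2_cintegrable (cL2_cst _)].
by rewrite cexpectation_cst mul1r subrr.
Qed.

Lemma ccovariance_center Z W : cL2 Z -> cL2 W ->
  ccovariance P (fun w => Z w - cexpectation P Z) W = ccovariance P Z W.
Proof.
move=> lZ lW; under eq_fun do rewrite -[Z _]mul1r.
rewrite ccovariance_linl//; last exact: cL2_cst.
by rewrite ccovariance_cst// mul1r addr0.
Qed.

(* No conjugation in the covariance: with [s + i t] its value, expand
   [s^2 + t^2 = E (s Re (Z W) + t Im (Z W))] and bound the integrand by AM-GM. *)
Lemma ccovariance_cs Z W : cL2 Z -> cL2 W ->
  normc (ccovariance P Z W) ^+ 2 <= real_cvariance Z * real_cvariance W.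
Proof.
move=> lZ lW; pose Z0 w := Z w - cexpectation P Z; pose W0 w := W w - cexpectation P W.
have lZ0 : cL2 Z0 by exact: cL2_sub_cst.
have lW0 : cL2 W0 by exact: cL2_sub_cst.
have -> : ccovariance P Z W = cexpectation P (fun w => Z0 w * W0 w).
  rewrite -(ccovariance_center lZ lW) ccovarianceC -(ccovariance_center lW lZ0).
  rewrite ccovarianceC /ccovariance.
  by rewrite (cexpectation_center lZ) mul0r subr0.
rewrite cexpectationE; set s := E _; set t := E _.
rewrite normc_sqr /=.
have iN2 := cL2_mul lZ0 lW0.
apply: le_of_quadratic; rewrite ?real_cvariance_ge0 ?addr_ge0 ?sqr_ge0// => c c0.
have iZ := integ_normc2 lZ0; have iW := integ_normc2 lW0.
have -> : 2 * c * (s ^+ 2 + t ^+ 2) =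
  E (fun w => 2 * c * s * complex.Re (Z0 w * W0 w) + 2 * c * t * complex.Im (Z0 w * W0 w)).
  rewrite meanD; [|exact: integZ iN2.1|exact: integZ iN2.2].
  by rewrite meanZ ?meanZ; [rewrite -/s -/t; ring|exact: iN2.2|exact: iN2.1].
have -> : c ^+ 2 * real_cvariance Z + (s ^+ 2 + t ^+ 2) * real_cvariance W =
    E (fun w => c ^+ 2 * normc (Z0 w) ^+ 2 + (s ^+ 2 + t ^+ 2) * normc (W0 w) ^+ 2).
  by rewrite (meanD (integZ _ iZ) (integZ _ iW)) (meanZ _ iZ) (meanZ _ iW).
apply: mean_le.
- by apply: integD; [exact: integZ iN2.1|exact: integZ iN2.2].
- by apply: integD; exact: integZ.
move=> w; rewrite !normc_sqr; case: (Z0 w) (W0 w) => a b [p q] /=.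
have := sqr_ge0 (c * a - (s * p + t * q)); have := sqr_ge0 (c * b - (t * p - s * q)).
rewrite !sqrrB; lra.
Qed.

End L2.

(** * Linear statistics of eigenvalues *)

Section Tame.
Variable R : realType.
Local Notation C := R[i].
Implicit Types h g : R -> R.

(** The growth is measured by an even power, so that the dominating sum over eigenvalues is itself a
    constant plus a trace of a power, with no absolute value to handle. *)
Definition tame h := continuous h /\ exists c k, forall x, `|h x| <= c * (1 + (x ^+ k) ^+ 2).

Lemma tame_bound h : tame h ->
  exists c k, 0 <= c /\ forall x, `|h x| <= c * (1 + (x ^+ k) ^+ 2).
Proof.
move=> [_ [c [k hc]]]; exists c, k; split => //.
have := hc 0; have : 1 <= 1 + ((0 : R) ^+ k) ^+ 2 by rewrite lerDl sqr_ge0.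
have := normr_ge0 (h 0); set u := 1 + _; set v := `|_|; move=> v0 u1 vcu.
by rewrite -(pmulr_lge0 _ (lt_le_trans ltr01 u1)) (le_trans v0).
Qed.

(** Brings two growth bounds to a common exponent; the 1 covers the region [x^2 <= 1], where higher
    powers are smaller. *)
Lemma sqr_exp_le (x : R) k l : (x ^+ k) ^+ 2 <= 1 + (x ^+ (k + l)) ^+ 2.
Proof.
rewrite exprD exprMn -!exprM !(mulnC _ 2) !exprM.
have : 0 <= x ^+ 2 by exact: sqr_ge0.
move: (x ^+ 2) => y y0; have [y1|y1] := leP y 1.
  rewrite (@le_trans _ _ 1)//; first exact: exprn_ile1.
  by rewrite lerDl mulr_ge0// exprn_ge0.
rewrite (@le_trans _ _ (y ^+ k * y ^+ l))//; last by rewrite lerDr.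
by rewrite ler_peMr ?exprn_ge0// exprn_ege1// ltW.
Qed.

Lemma tame_cst (a : R) : tame (fun=> a).
Proof.
split; first by move=> x; exact: cvg_cst.
exists `|a|, 0%N => x; rewrite expr0 expr1n.
by have := normr_ge0 a; lra.
Qed.

Lemma tameD h g : tame h -> tame g -> tame (fun x => h x + g x).
Proof.
move=> th tg; have [c [k [c0 hc]]] := tame_bound th.
have [e [l [e0 ge]]] := tame_bound tg.
split; first by move=> x; apply: cvgD; [exact: th.1|exact: tg.1].
exists (2 * (c + e)), (k + l)%N => x; rewrite (le_trans (ler_normD _ _))//.
have xk := sqr_exp_le x k l; have xl := sqr_exp_le x l k; rewrite addnC in xl.
rewrite (le_trans (lerD (hc x) (ge x)))//.
rewrite (@le_trans _ _ (c * (2 * (1 + (x ^+ (k + l)) ^+ 2)) +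
    e * (2 * (1 + (x ^+ (k + l)) ^+ 2))))//; last by lra.
have := sqr_ge0 (x ^+ (k + l)) => s0.
by rewrite lerD// ler_wpM2l//; lra.
Qed.

Lemma tameM h g : tame h -> tame g -> tame (fun x => h x * g x).
Proof.
move=> th tg; have [c [k [c0 hc]]] := tame_bound th.
have [e [l [e0 ge]]] := tame_bound tg.
split; first by move=> x; apply: cvgM; [exact: th.1|exact: tg.1].
(* The product of the two growth factors expands into four terms, each at most
   [1 + (x ^+ (k + l)) ^+ 2]. *)
exists (4 * (c * e)), (k + l)%N => x; rewrite normrM.
rewrite (le_trans (ler_pM _ _ (hc x) (ge x)))//.
have xk := sqr_exp_le x k l; have xl := sqr_exp_le x l k; rewrite addnC in xl.
have ce : 0 <= c * e by rewrite mulr_ge0.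
have -> : c * (1 + (x ^+ k) ^+ 2) * (e * (1 + (x ^+ l) ^+ 2)) =
   (c * e) * (1 + (x ^+ k) ^+ 2 + (x ^+ l) ^+ 2 + (x ^+ (k + l)) ^+ 2).
  by rewrite exprD exprMn; ring.
have := sqr_ge0 (x ^+ (k + l)) => s0.
rewrite (_ : 4 * _ * _ = c * e * (4 * (1 + (x ^+ (k + l)) ^+ 2))); last by ring.
by rewrite ler_wpM2l//; lra.
Qed.

Lemma tameZ (a : R) h : tame h -> tame (fun x => a * h x).
Proof. by move=> th; exact: tameM (tame_cst a) th. Qed.

Lemma tameX h n : tame h -> tame (fun x => h x ^+ n).
Proof.
move=> th; elim: n => [|n IH]; first exact: tame_cst.
by under eq_fun do rewrite exprS; exact: tameM.
Qed.

Lemma tame_le h g : continuous h -> tame g -> (forall x, `|h x| <= `|g x|) -> tame h.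
Proof.
move=> ch [_ [c [k gc]]] hg; split => //; exists c, k => x.
exact: le_trans (hg x) (gc x).
Qed.

Lemma tame_id : tame id.
Proof.
split; first by move=> x; exact: cvg_id.
exists 1, 1%N => x; rewrite expr1 mul1r.
have := sqr_ge0 (`|x| - 1); rewrite -(real_normK (num_real x)).
have := normr_ge0 x; nra.
Qed.

Lemma tame_poly (p : {poly R}) : tame (horner p).
Proof.
elim/poly_ind: p => [|p c IH].
  by rewrite (_ : horner 0 = fun=> 0); [exact: tame_cst|apply/funext => x; rewrite horner0].
rewrite (_ : horner _ = fun x => p.[x] * x + c).
  by apply: tameD (tame_cst c); exact: tameM tame_id.
by apply/funext => x; rewrite !hornerE.
Qed.

Lemma tame_norm h : tame h -> tame (fun x => `|h x|).
Proof.
move=> th; apply: (tame_le _ th) => [x|x]; last by rewrite normr_id.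
by apply: cvg_norm; exact: th.1.
Qed.

Definition ctame (f : R -> C) :=
  tame (fun x => complex.Re (f x)) /\ tame (fun x => complex.Im (f x)).

Lemma continuous_normc (f : R -> C) : continuous (fun x => complex.Re (f x)) ->
  continuous (fun x => complex.Im (f x)) -> continuous (fun x => normc (f x)).
Proof.
move=> cr ci x.
rewrite (_ : (fun x => normc (f x)) =
    (fun x => Num.sqrt (complex.Re (f x) ^+ 2 + complex.Im (f x) ^+ 2))); last first.
  by apply/funext => y; case: (f y).
apply: (@continuous_comp _ _ _ (fun x => complex.Re (f x) ^+ 2 + complex.Im (f x) ^+ 2)
  Num.sqrt); last exact: sqrt_continuous.
by apply: cvgD; apply: cvgM; [exact: cr|exact: cr|exact: ci|exact: ci].
Qed.

Lemma tame_normc (f : R -> C) : ctame f -> tame (fun x => normc (f x)).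
Proof.
move=> [tr ti]; apply: (@tame_le _ _ _ (tameD (tame_norm tr) (tame_norm ti))).
  exact: continuous_normc tr.1 ti.1.
move=> x; rewrite ger0_norm ?normc_ge0// (le_trans (normc_le_ReIm _))//.
exact: ler_norm.
Qed.

End Tame.

(** * Measurability, integrability and tail estimates for sums over eigenvalues *)

Section SumEig.
Context d (T : measurableType d) (R : realType) (P : probability T R).
Context (n : nat) (X : T -> 'M[R[i]]_n).
Hypothesis X_herm : forall w, X w \is hermsymmx.
Hypothesis X_moments : finite_trace_moments P X.
Implicit Types h g : R -> R.

Local Notation E X := (Rintegral P setT X).
Local Notation integ X := (P.-integrable setT (EFin \o X)).
Local Notation S h := (fun w => sum_eig h (X w)).

Lemma integ_sum_eig_exp k : integ (S (fun x => x ^+ k)).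
Proof.
have [+ _] := X_moments.1 k; apply: eq_integrable => // w _.
by rewrite /= tr_expmx.
Qed.

Lemma sum_eig_poly (p : {poly R}) w :
  sum_eig (horner p) (X w) = \sum_(i < size p) p`_i * sum_eig (fun x => x ^+ i) (X w).
Proof.
under eq_bigr do rewrite mulr_sumr; rewrite exchange_big/=.
by apply: eq_bigr => k _; rewrite horner_coef.
Qed.

(** Traces of powers are integrable, hence measurable, and so are the sums for polynomials. A
    polynomial within [1 / (m + 1)] of [h] on [[-(m + 1), m + 1]] is accurate at all eigenvalues of
    a given outcome once [m] is large, since these are finitely many. *)
Lemma measurable_sum_eig h : continuous h -> measurable_fun setT (S h).
Proof.
move=> ch.
have /choice[p hp] : forall m : nat, exists p : {poly R}, forall x,
    - m.+1%:R <= x <= m.+1%:R -> `|h x - p.[x]| <= m.+1%:R^-1.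
  by move=> m; apply: weierstrass; rewrite // invr_gt0.
apply: (@measurable_fun_cvg _ _ _ _ (fun m => S (horner (p m)))).
  move=> m; under eq_fun do rewrite sum_eig_poly.
  apply: measurable_sum => i; apply: measurable_funM; first exact: measurable_cst.
  exact: integ_meas (integ_sum_eig_exp _).
move=> w _; apply: cvg_big => [|k _ /=]; first exact: add_continuous.
set x := eig _ _.
apply/cvgrPdist_le => e e0; near=> m.
have xm : `|x| <= m.+1%:R.
  by rewrite (@le_trans _ _ m%:R) ?ler_nat//; near: m; exact: nbhs_infty_ger.
rewrite (le_trans (hp m x _)) -?ler_norml//.
by near: m; apply: filterS (near_infty_natSinv_lt (PosNum e0)) => m /ltW.
Unshelve. all: by end_near. Qed.

Lemma sum_eig_le h g (A : 'M[R[i]]_n) : (forall x, h x <= g x) ->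
  sum_eig h A <= sum_eig g A.
Proof. by move=> hg; apply: ler_sum => k _. Qed.

Lemma norm_sum_eig_le h (A : 'M[R[i]]_n) :
  `|sum_eig h A| <= sum_eig (fun x => `|h x|) A.
Proof. exact: ler_norm_sum. Qed.

Lemma sum_eig_growth c k (A : 'M[R[i]]_n) :
  sum_eig (fun x => c * (1 + (x ^+ k) ^+ 2)) A =
  c * (n%:R + sum_eig (fun x => x ^+ (k * 2)) A).
Proof.
rewrite /sum_eig -mulr_sumr big_split/= sumr_const card_ord.
by under [X in _ + X]eq_bigr do rewrite -exprM.
Qed.

Lemma integ_sum_eig h : tame h -> integ (S h).
Proof.
move=> th; have [c [k [c0 hc]]] := tame_bound th.
apply: (integ_le (measurable_sum_eig th.1)
  (integZ c (integD (integ_cst P n%:R) (integ_sum_eig_exp (k * 2))))) => w.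
rewrite (le_trans (norm_sum_eig_le _ _))// -sum_eig_growth.
exact: sum_eig_le.
Qed.

(** The sum of the squared deviations of the values of [h] from their mean [t] is nonnegative. The
    factor [n] paid here is a source of the powers of [N] that the tail probability has to beat. *)
Lemma sum_eig_sqr h (A : 'M[R[i]]_n) :
  sum_eig h A ^+ 2 <= n%:R * sum_eig (fun x => h x ^+ 2) A.
Proof.
have [n0|n0] := posnP n.
  move: A; rewrite n0 => A; rewrite /sum_eig !big_ord0 expr0n mulr0 lexx//.
have N0 : (0 : R) < n%:R by rewrite ltr0n.
pose t := sum_eig h A / n%:R.
have : 0 <= sum_eig (fun x => (h x - t) ^+ 2) A.
  by apply: sumr_ge0 => k _; exact: sqr_ge0.
have -> : sum_eig (fun x => (h x - t) ^+ 2) A =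
  sum_eig (fun x => h x ^+ 2) A - 2 * t * sum_eig h A + n%:R * t ^+ 2.
  rewrite /sum_eig mulr_sumr -sumrB.
  have -> : n%:R * t ^+ 2 = \sum_(k < n) t ^+ 2.
    by rewrite sumr_const card_ord mulr_natl.
  by rewrite -big_split/=; apply: eq_bigr => k _; ring.
rewrite -(pmulr_rge0 _ N0) => le; rewrite -subr_ge0; apply: (le_trans le).
by rewrite /t le_eqVlt; apply/orP; left; apply/eqP; field; rewrite lt0r_neq0.
Qed.

Lemma L2_sum_eig h : tame h -> L2 P (S h).
Proof.
move=> th; split; first exact: measurable_sum_eig th.1.
apply: (integ_le _ (integZ n%:R (integ_sum_eig (tameX 2 th)))).
  by apply: measurable_funX; exact: measurable_sum_eig th.1.
by move=> w; rewrite ger0_norm ?sqr_ge0// sum_eig_sqr.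
Qed.

Lemma cL2_trf (f : R -> R[i]) : ctame f -> cL2 P (fun w => trf f (X w)).
Proof.
move=> [tr ti]; split.
  by under eq_fun do rewrite Re_trf; exact: L2_sum_eig.
by under eq_fun do rewrite Im_trf; exact: L2_sum_eig.
Qed.

Lemma mean_sum_eig_sqr h : tame h ->
  E (fun w => sum_eig h (X w) ^+ 2) <= n%:R * E (S (fun x => h x ^+ 2)).
Proof.
move=> th; rewrite -(meanZ _ (integ_sum_eig (tameX 2 th))).
apply: mean_le => [||w]; [exact: (L2_sum_eig th).2| |exact: sum_eig_sqr].
exact: integZ (integ_sum_eig (tameX 2 th)).
Qed.

Variable M : R.
Hypothesis M_gt0 : 0 < M.

Definition tail := [set w | M < opnorm (X w)].

Lemma tailP w : tail w <-> exists k, M < `|eig (X w) k|.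
Proof. by apply: opnorm_gtP => //; exact: ltW. Qed.

(** The tail event is the event that the sum of the continuous function [max (|x| - M) 0] over the
    eigenvalues is positive. *)
Lemma measurable_tail : measurable tail.
Proof.
pose g (x : R) := Num.max (`|x| - M) 0.
have cg : continuous g.
  move=> x; apply: (@continuous_max _ _ (fun x => `|x| - M) (fun=> 0)).
    by apply: cvgB; [apply: cvg_norm; exact: cvg_id|exact: cvg_cst].
  exact: cvg_cst.
have g0 x : 0 <= g x by rewrite le_max lexx orbT.
have -> : tail = (S g) @^-1` `]0, +oo[%classic.
  apply/seteqP; split => w; rewrite /= in_itv/= andbT.
    move=> /tailP[k kM]; rewrite /sum_eig (bigD1 k)//= ltr_pwDl//.
      by rewrite lt_max subr_gt0 kM.
    by apply: sumr_ge0.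
  move=> S0; apply/tailP; apply: contrapT => /forallNP nk; move: S0.
  rewrite /sum_eig big1 ?ltxx// => k _; apply/max_idPr.
  by rewrite subr_le0 leNgt; apply/negP.
rewrite -[X in measurable X]setTI; apply: measurable_sum_eig => //.
Qed.

(** Off the tail event every eigenvalue lies where [h] vanishes, so the squared sum may be
    multiplied by the indicator of that event, and Cauchy-Schwarz splits off its probability. The
    factor [n ^+ 3] comes from using [sum_eig_sqr] twice, the first time squared. *)
Lemma mean_tail h : tame h -> (forall x, - M <= x <= M -> h x = 0) ->
  E (fun w => sum_eig h (X w) ^+ 2) ^+ 2 <=
  fine (P tail) * (n%:R ^+ 3 * E (S (fun x => h x ^+ 4))).
Proof.
move=> th h0; have t2 := tameX 2 th.
pose I w : R := \1_tail w.
pose Y w := sum_eig h (X w) ^+ 2.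
have mI : measurable_fun setT I by exact: measurable_indic measurable_tail.
have II w : I w ^+ 2 = I w by rewrite /I indicE; case: (_ \in _); rewrite ?expr1n ?expr0n.
have le4 w : Y w ^+ 2 <= n%:R ^+ 3 * sum_eig (fun x => h x ^+ 4) (X w).
  have S0 : 0 <= sum_eig (fun x => h x ^+ 2) (X w).
    by apply: sumr_ge0 => k _; exact: sqr_ge0.
  rewrite /Y (@le_trans _ _ ((n%:R * sum_eig (fun x => h x ^+ 2) (X w)) ^+ 2))//.
    by rewrite ler_pXn2r ?nnegrE ?sqr_ge0 ?mulr_ge0// sum_eig_sqr.
  rewrite exprMn (exprSr n%:R 2) -mulrA ler_wpM2l ?exprn_ge0//.
  rewrite (le_trans (sum_eig_sqr _ _))// ler_wpM2l// sum_eig_le// => x.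
  by rewrite -exprM.
have lI : L2 P I.
  split => //; under eq_fun do rewrite II.
  apply: integ_le (integ_cst P 1) _ => // w.
  by rewrite /I indicE; case: (_ \in _); rewrite ?normr1 ?normr0.
have lY : L2 P Y.
  have mY : measurable_fun setT Y by apply: measurable_funX; exact: measurable_sum_eig th.1.
  split => //; apply: integ_le (integZ (n%:R ^+ 3) (integ_sum_eig (tameX 4 th))) _.
    exact: measurable_funX.
  by move=> w; rewrite ger0_norm ?sqr_ge0.
have -> : E (fun w => sum_eig h (X w) ^+ 2) = E (fun w => I w * Y w).
  apply: eq_Rintegral => w _; rewrite /I indicE /Y.
  have [_|] := boolP (w \in tail); first by rewrite mul1r.
  move=> /negP wt; rewrite mul0r /sum_eig big1 ?expr0n// => k _; apply: h0.
  rewrite -ler_norml leNgt; apply/negP => kM; apply: wt.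
  by rewrite inE; apply/tailP; exists k.
apply: (le_trans (cauchy_schwarz lI lY)); apply: ler_pM.
- exact: mean_sqr_ge0.
- exact: mean_sqr_ge0.
- under eq_Rintegral do rewrite II.
  by rewrite /Rintegral integral_indic ?setIT//; exact: measurable_tail.
- rewrite -(meanZ _ (integ_sum_eig (tameX 4 th))); apply: mean_le => //; first exact: lY.2.
  exact: integZ (integ_sum_eig (tameX 4 th)).
Qed.

Lemma real_cvariance_trf_le (f : R -> R[i]) : ctame f ->
  real_cvariance P (fun w => trf f (X w)) <= E (fun w => sum_eig (fun x => normc (f x)) (X w) ^+ 2).
Proof.
move=> tf; have lf := cL2_trf tf; apply: le_trans (real_cvariance_le lf) _.
apply: mean_le => [||w].
- exact: integ_normc2.
- exact: (L2_sum_eig (tame_normc tf)).2.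
rewrite ler_pXn2r ?nnegrE ?normc_ge0 ?sumr_ge0// => [|k _]; last exact: normc_ge0.
exact: normc_sum.
Qed.

End SumEig.

(** * Complex-valued C1 functions *)

Section ComplexC1.
Variable R : realType.
Local Notation C := R[i].
Implicit Types f g : R -> C.

Lemma C1P f : C1 f <->
  C1_with (fun x => complex.Re (f x)) (fun x => complex.Re (cderive f x)) /\
  C1_with (fun x => complex.Im (f x)) (fun x => complex.Im (cderive f x)).
Proof.
split=> [[dr di cr ci]|[[dr cr] [di ci]]].
  by split; split => // x; rewrite /cderive/= derive1E; exact: derivableP.
by split; [move=> x; case: (dr x)|move=> x; case: (di x)|exact: cr|exact: ci].
Qed.

Lemma C1_of_parts f (a b : R -> R) :
  C1_with (fun x => complex.Re (f x)) a -> C1_with (fun x => complex.Im (f x)) b ->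
  C1 f /\ cderive f = (fun x => (a x +i* b x)%C).
Proof.
move=> fa fb; have e : cderive f = (fun x => (a x +i* b x)%C).
  apply/funext => x; rewrite /cderive !derive1E.
  by have [_ ->] := fa.1 x; have [_ ->] := fb.1 x.
by split => //; apply/C1P; rewrite e.
Qed.

Lemma C1_with_continuous (h h' : R -> R) : C1_with h h' -> continuous h.
Proof.
move=> [dh _] x; apply: differentiable_continuous; apply/derivable1_diffP.
by have [] := dh x.
Qed.

Lemma C1_withD (h h' k k' : R -> R) : C1_with h h' -> C1_with k k' ->
  C1_with (fun x => h x + k x) (fun x => h' x + k' x).
Proof.
move=> [dh ch] [dk ck]; split; last by move=> x; apply: cvgD; [exact: ch|exact: ck].
by move=> x; exact: is_deriveD (dh x) (dk x).
Qed.

Lemma C1_withZ (a : R) (h h' : R -> R) : C1_with h h' ->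
  C1_with (fun x => a * h x) (fun x => a * h' x).
Proof.
move=> [dh ch]; split; last by move=> x; apply: cvgM; [exact: cvg_cst|exact: ch].
move=> x; have ? := dh x; apply: is_derive_eq; rewrite /GRing.scale/=; ring.
Qed.

Lemma C1_lin (a : C) f g : C1 f -> C1 g ->
  C1 (fun x => a * f x + g x) /\
  cderive (fun x => a * f x + g x) = (fun x => a * cderive f x + cderive g x).
Proof.
move=> /C1P[fr fi] /C1P[gr gi]; case: a => a b.
have er : (fun x => complex.Re ((a +i* b)%C * f x + g x)) = (fun x =>
    a * complex.Re (f x) + (- b * complex.Im (f x) + complex.Re (g x))).
  by apply/funext => x; case: (f x) (g x) => p q [r s] /=; ring.
have ei : (fun x => complex.Im ((a +i* b)%C * f x + g x)) = (fun x =>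
    a * complex.Im (f x) + (b * complex.Re (f x) + complex.Im (g x))).
  by apply/funext => x; case: (f x) (g x) => p q [r s] /=; ring.
have [|//|h e] := @C1_of_parts (fun x => (a +i* b)%C * f x + g x)
  (fun x => a * complex.Re (cderive f x) +
    (- b * complex.Im (cderive f x) + complex.Re (cderive g x)))
  (fun x => a * complex.Im (cderive f x) +
    (b * complex.Re (cderive f x) + complex.Im (cderive g x))).
- by rewrite er; do !apply: C1_withD; rewrite //; exact: C1_withZ.
- by rewrite ei; do !apply: C1_withD; rewrite //; exact: C1_withZ.
split => //; rewrite e; apply/funext => x; case: (cderive f x) (cderive g x) => p q [r s] /=.
by apply/eqP; rewrite eq_complex /=; apply/andP; split; apply/eqP; ring.
Qed.

Lemma poly_bounded_tame f : C1 f -> poly_bounded f -> ctame f.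
Proof.
move=> /C1P[fr fi] [c [k fc]].
have b x : c * (1 + `|x| ^+ k) <= `|c| * 2 * (1 + (x ^+ k) ^+ 2).
  rewrite (@le_trans _ _ (`|c| * (1 + `|x| ^+ k)))//.
    by rewrite ler_wpM2r ?ler_norm// addr_ge0 ?exprn_ge0.
  rewrite -mulrA ler_wpM2l// -normrX.
  have := sqr_ge0 (`|x ^+ k| - 1); rewrite -(real_normK (num_real (x ^+ k))).
  have := normr_ge0 (x ^+ k); nra.
split; split; try exact: C1_with_continuous fr; try exact: C1_with_continuous fi.
- exists (`|c| * 2), k => x; rewrite (le_trans (normRe_le _))//.
  exact: le_trans (fc x) (b x).
- exists (`|c| * 2), k => x; rewrite (le_trans (normIm_le _))//.
  exact: le_trans (fc x) (b x).
Qed.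

Lemma tame_poly_bounded f : ctame f -> poly_bounded f.
Proof.
move=> /tame_normc/tame_bound[c [k [c0 fc]]]; exists c, (k * 2)%N => x.
rewrite (le_trans _ (le_trans (fc x) _)) ?ler_norm//.
rewrite -exprM (le_trans (ler_norm _))// normrM (ger0_norm c0).
by rewrite ler_wpM2l// (le_trans (ler_normD _ _))// normr1 normrX.
Qed.

Lemma classSP f : classS f <-> C1 f /\ ctame f.
Proof.
split=> [[cf bf]|[cf tf]]; split => //; first exact: poly_bounded_tame.
exact: tame_poly_bounded.
Qed.

Lemma ctame_lin (a : C) f g : ctame f -> ctame g -> ctame (fun x => a * f x + g x).
Proof.
move=> [fr fi] [gr gi]; split.
- rewrite (_ : (fun x => _) = (fun x => complex.Re a * complex.Re (f x) +
      (- complex.Im a * complex.Im (f x) + complex.Re (g x)))).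
    by do !apply: tameD; rewrite //; exact: tameZ.
  by apply/funext => x; case: a (f x) (g x) => a b [p q] [r s] /=; ring.
- rewrite (_ : (fun x => _) = (fun x => complex.Re a * complex.Im (f x) +
      (complex.Im a * complex.Re (f x) + complex.Im (g x)))).
    by do !apply: tameD; rewrite //; exact: tameZ.
  by apply/funext => x; case: a (f x) (g x) => a b [p q] [r s] /=; ring.
Qed.

Lemma classS_lin (a : C) f g : classS f -> classS g ->
  classS (fun x => a * f x + g x).
Proof.
move=> /classSP[cf tf] /classSP[cg tg]; apply/classSP.
by split; [exact: (C1_lin a cf cg).1|exact: ctame_lin].
Qed.

Lemma C1_horner (p : {poly R}) : C1_with (horner p) (horner p^`()).
Proof.
split=> x; last by apply: (tame_poly p^`()).1.
exact: is_derive_poly.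
Qed.

Lemma poly_fun_parts (p : {poly C}) : exists r s : {poly R},
  poly_fun p = (fun x => (r.[x] +i* s.[x])%C).
Proof.
elim/poly_ind: p => [|p c [r [s e]]].
  by exists 0, 0; apply/funext => x; rewrite /poly_fun !horner0.
exists (r * 'X + (complex.Re c)%:P), (s * 'X + (complex.Im c)%:P).
apply/funext => x; rewrite /poly_fun !hornerE.
have := congr1 (fun h => h x) e; rewrite /poly_fun => ->.
by case: c => a b; apply/eqP; rewrite eq_complex /=; apply/andP; split; apply/eqP; ring.
Qed.

Lemma classS_poly (p : {poly C}) : classS (poly_fun p).
Proof.
have [r [s ->]] := poly_fun_parts p; apply/classSP; split.
  by apply: (C1_of_parts _ _).1; exact: C1_horner.
by split; exact: tame_poly.
Qed.

Lemma poly_primitive (p : {poly R}) : exists q : {poly R}, q^`() = p.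
Proof.
(* At [i = 0] the quotient by zero is 0: this is the primitive without constant term. *)
exists (\poly_(i < (size p).+1) (p`_i.-1 / i%:R)).
apply/polyP => i; rewrite coef_deriv coef_poly ltnS /=.
case: ltnP => [_|ip]; first by rewrite -[_ *+ _]mulr_natr divfK// pnatr_eq0.
by rewrite mul0rn nth_default.
Qed.

(** Only derivatives are approximated; the constant of integration is left uncontrolled because the
    covariance bounds see derivatives only. *)
Lemma C1_weierstrass f (M e : R) : 0 < M -> 0 < e -> C1 f ->
  exists p : {poly C}, forall x, - M <= x <= M ->
    normc (cderive f x - cderive (poly_fun p) x) <= e.
Proof.
move=> M0 e0 /C1P[[_ cr] [_ ci]]; have e2 : 0 < e / 2 by rewrite divr_gt0.
have [r hr] := weierstrass cr M0 e2; have [s hs] := weierstrass ci M0 e2.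
have [r1 er] := poly_primitive r; have [s1 es] := poly_primitive s.
pose p : {poly C} := map_poly (real_complex R) r1 + 'i%C *: map_poly (real_complex R) s1.
have pE : poly_fun p = (fun x => (r1.[x] +i* s1.[x])%C).
  apply/funext => x; rewrite /poly_fun /p hornerD hornerZ !horner_map/=.
  by apply/eqP; rewrite eq_complex /=; apply/andP; split; apply/eqP; ring.
exists p => x xM; have [_ ->] : C1 (poly_fun p) /\
    cderive (poly_fun p) = (fun x => (r.[x] +i* s.[x])%C).
  by rewrite pE; apply: C1_of_parts => /=; rewrite -?er -?es; exact: C1_horner.
rewrite (le_trans (normc_le_ReIm _))// [leRHS](splitr e) lerD//.
  by have := hr x xM; case: (cderive f x).
by have := hs x xM; case: (cderive f x).
Qed.

Lemma tame_lin_ext (M : R) (h h' : R -> R) : 0 < M -> C1_with h h' ->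
  tame (lin_ext M h h').
Proof.
move=> M0 hh; have ch := C1_with_continuous hh.
have [c c0 hc] := @continuous_bounded_seg R h (- M) M ch.
have tt a : tame (tangent h h' a).
  apply: (tameD (tame_cst (h a))); apply: tameZ.
  exact: (tameD (@tame_id R) (tame_cst (- a))).
apply: (@tame_le _ _ (fun x => c + (`|tangent h h' (- M) x| + `|tangent h h' M x|))).
- exact: C1_with_continuous (C1_lin_ext M0 hh).
- by apply: (tameD (tame_cst c)); apply: tameD; exact: tame_norm.
move=> x; apply: le_trans (ler_norm _); rewrite /lin_ext /splice.
have t1 := normr_ge0 (tangent h h' (- M) x); have t2 := normr_ge0 (tangent h h' M x).
have [xM|_] := leP x M; last first.
  lra.
have [_|xM'] := leP x (- M); first by rewrite /=; lra.
by have /hc : - M <= x <= M; [rewrite xM ltW|lra].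
Qed.

(** The last clause turns any pointwise bound on the derivative over [[-M, M]] into a bound over the
    whole line, the form in which the variance hypothesis can be applied. *)
Lemma C1_extension f (M : R) : 0 < M -> C1 f -> exists g, [/\ classS g,
  forall x, - M <= x <= M -> g x = f x,
  forall x, - M <= x <= M -> cderive g x = cderive f x &
  forall x, exists2 t, - M <= t <= M & cderive g x = cderive f t].
Proof.
move=> M0 /C1P[fr fi].
pose r := lin_ext M (fun x => complex.Re (f x)) (fun x => complex.Re (cderive f x)).
pose s := lin_ext M (fun x => complex.Im (f x)) (fun x => complex.Im (cderive f x)).
have cr : C1_with r _ := C1_lin_ext M0 fr.
have cs : C1_with s _ := C1_lin_ext M0 fi.
have [c1 e] := @C1_of_parts (fun x => (r x +i* s x)%C) _ _ cr cs.
exists (fun x => (r x +i* s x)%C); split.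
- apply/classSP; split => //; split.
    exact: tame_lin_ext fr.
  exact: tame_lin_ext fi.
- by move=> x xM; rewrite /r /s !lin_extE//; case: (f x).
- by move=> x xM; rewrite e clamp_id//; case: (cderive f x).
- move=> x; exists (clamp M x); first exact/clamp_in/ltW.
  by rewrite e; case: (cderive f _).
Qed.

Lemma le_supnorm_seg f (M x : R) : C1 f -> - M <= x <= M ->
  normc (cderive f x) <= supnorm_seg M (cderive f).
Proof.
move=> /C1P[[_ cr] [_ ci]] xM; rewrite /supnorm_seg; apply: ub_le_sup.
  have [c _ hc] := @continuous_bounded_seg R _ (- M) M (continuous_normc cr ci).
  by exists c => _ [y /= yM <-]; rewrite (le_trans (ler_norm _))// hc//; move: yM; rewrite in_itv.
by exists x => //=; rewrite in_itv.
Qed.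

End ComplexC1.

(** * Complex limits *)

Section ComplexLimits.
Variable R : realType.
Local Notation C := R[i].
Implicit Types (u v : nat -> C) (l z : C).

(** Convergence tested with real [e], for any filter: it serves both for [\oo] and for the
    ultrafilter that defines [u]. *)
Definition ccvg (F : set_system nat) u l :=
  forall e : R, 0 < e -> \forall n \near F, normc (u n - l) < e.

Lemma ccvgP u l : (fun n => u n : C^o) @ \oo --> (l : C^o) <-> ccvg \oo u l.
Proof.
split=> [/cvgrPdist_lt ul e e0|ul].
  have e0' : (0 : C) < (e%:C)%C by rewrite ltcR.
  apply: filterS (ul _ e0') => n; rewrite -normcN opprB.
  by rewrite -ltcR.
(* The norm is complex-valued here, and so is the tolerance; being positive, it has imaginary part
   0. *)
apply/cvgrPdist_lt => -[e e']; rewrite ltcE/= => /andP[/eqP -> e0].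
apply: filterS (ul _ e0) => n; rewrite -normcN opprB -ltcR.
done.
Qed.

Section AnyFilter.
Context (F : set_system nat) {FF : ProperFilter F}.

Lemma ccvg_cst l : ccvg F (fun=> l) l.
Proof. by move=> e e0; near=> n; rewrite subrr Normc.normc0.
Unshelve. all: by end_near. Qed.

Lemma ccvg_lin a u v l z : ccvg F u l -> ccvg F v z -> ccvg F (fun n => a * u n + v n) (a * l + z).
Proof.
move=> ul vz e e0; have a1 : 0 < normc a + 1 by rewrite ltr_wpDl ?normc_ge0.
have ea : 0 < e / 2 / (normc a + 1) by rewrite !divr_gt0.
have e2 : 0 < e / 2 by rewrite divr_gt0.
near=> n; have -> : a * u n + v n - (a * l + z) = a * (u n - l) + (v n - z) by ring.
rewrite (le_lt_trans (normcD _ _))// [ltRHS](splitr e) ler_ltD//; last first.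
  by near: n; exact: vz.
have : normc (u n - l) < e / 2 / (normc a + 1) by near: n; exact: ul.
rewrite ltr_pdivlMr// Normc.normcM => h.
by have := normc_ge0 (u n - l); have := normc_ge0 a; lra.
Unshelve. all: by end_near. Qed.

Lemma ccvgD u v l z : ccvg F u l -> ccvg F v z -> ccvg F (fun n => u n + v n) (l + z).
Proof.
move=> ul vz; have := ccvg_lin 1 ul vz; rewrite mul1r.
by under eq_fun do rewrite mul1r.
Qed.

Lemma ccvg_sum (I : Type) (r : seq I) (u : I -> nat -> C) (l : I -> C) :
  (forall i, ccvg F (u i) (l i)) ->
  ccvg F (fun n => \sum_(i <- r) u i n) (\sum_(i <- r) l i).
Proof.
move=> ul; elim: r => [|i r IH].
  by rewrite big_nil; under eq_fun do rewrite big_nil; exact: ccvg_cst.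
by rewrite big_cons; under eq_fun do rewrite big_cons; exact: ccvgD.
Qed.

Lemma ccvg_le u l (b : R) : ccvg F u l ->
  (forall e, 0 < e -> \forall n \near F, normc (u n) <= b + e) -> normc l <= b.
Proof.
move=> ul ub; apply/ler_addgt0Pr => e e0; have e2 : 0 < e / 2 by rewrite divr_gt0.
near F => n.
have h1 : normc (u n - l) < e / 2 by near: n; exact: ul.
have h2 : normc (u n) <= b + e / 2 by near: n; exact: ub.
have := normcB (u n) (u n - l); rewrite opprB addrC subrK; lra.
Unshelve. all: by end_near. Qed.

Lemma ccvg_unique u l z : ccvg F u l -> ccvg F u z -> l = z.
Proof.
move=> ul uz; apply/eqP; rewrite -subr_eq0; apply/eqP/normc_le0.
apply: (ccvg_le (ccvg_cst (l - z))) => e e0.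
have e2 : 0 < e / 2 by rewrite divr_gt0.
near=> n.
have h1 : normc (u n - l) < e / 2 by near: n; exact: ul.
have h2 : normc (u n - z) < e / 2 by near: n; exact: uz.
rewrite add0r; have := normcB (u n - z) (u n - l).
by rewrite (_ : u n - z - (u n - l) = l - z); [lra|ring].
Unshelve. all: by end_near. Qed.

Lemma ccvg_eq u v l : ccvg F u l -> ccvg F (fun n => v n - u n) 0 -> ccvg F v l.
Proof.
move=> ul vu; have := ccvgD ul vu; rewrite addr0.
by under eq_fun do rewrite addrC subrK.
Qed.

End AnyFilter.

(** Such a sequence is Cauchy, and completeness is applied to real and imaginary parts. This carries
    convergence from polynomials to the whole class by density. *)
Lemma ccvg_approx u : (forall e : R, 0 < e -> exists v l, ccvg \oo v l /\
  \forall n \near \oo, normc (u n - v n) <= e) -> exists l, ccvg \oo u l.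
Proof.
move=> uP.
have cau (g : C -> R) : (forall z w, g z - g w = g (z - w)) ->
    (forall z, `|g z| <= normc z) -> exists l : R, (g \o u) @ \oo --> l.
  move=> gB gn; suff /cauchy_cvgP/cvg_ex[l ?] : cauchy ((g \o u) @ \oo) by exists l.
  apply: cauchy_exP => e e0; have e2 : 0 < e / 2 by rewrite divr_gt0.
  have [v [l [vl uv]]] := uP _ e2; exists (g l).
  suff : \forall n \near \oo, `|g l - g (u n)| < e by [].
  near=> n.
  rewrite gB (le_lt_trans (gn _))//.
  have h1 : normc (v n - l) < e / 2 by near: n; exact: vl.
  have h2 : normc (u n - v n) <= e / 2 by near: n; exact: uv.
  rewrite -normcN opprB (_ : u n - l = u n - v n + (v n - l)); last by ring.
  by rewrite (le_lt_trans (normcD _ _))//; lra.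
have [||a ha] := cau (@complex.Re R); [by move=> [? ?] []|exact: normRe_le|].
have [||b hb] := cau (@complex.Im R); [by move=> [? ?] []|exact: normIm_le|].
exists (a +i* b)%C => e e0; have e2 : 0 < e / 2 by rewrite divr_gt0.
near=> n; rewrite (le_lt_trans (normc_le_ReIm _))// [ltRHS](splitr e) ltrD//.
  have : `|a - complex.Re (u n)| < e / 2.
    by near: n; move/cvgrPdist_lt : ha => /(_ _ e2).
  by rewrite distrC; case: (u n).
have : `|b - complex.Im (u n)| < e / 2.
  by near: n; move/cvgrPdist_lt : hb => /(_ _ e2).
by rewrite distrC; case: (u n).
Unshelve. all: by end_near. Qed.

End ComplexLimits.

(** * Asymptotics of the covariances *)

Section Ensemble.
Context (R : realType) (d : nat -> measure_display)
    (T : forall N, measurableType (d N)) (P : forall N, probability (T N) R)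
    (X : forall N, T N -> 'M[R[i]]_N).
Arguments X : clear implicits.
Hypothesis X_ens : selfadjoint_ensemble P X.
Context (M K : R) (alpha1 : nat -> R[i]).
Hypotheses (M_gt0 : 0 < M) (K_gt0 : 0 < K).
Hypothesis lim_moments : forall n : nat, (0 < n)%N ->
  (fun N : nat => (N%:R)^-1 *
     cexpectation (P N) (fun w => \tr (X N w ^+ n)) : R[i]^o) @ \oo
    --> (alpha1 n : R[i]^o).
Hypothesis norm_tail :
  (fun N : nat =>
     ((N%:R ^+ 8)%:E * P N [set w | (M < opnorm (X N w))%R])%E) @ \oo
    --> (0%E : \bar R).
Hypothesis var_bound : forall (f : R -> R[i]) (N : nat), C1 f ->
  (cvariance (P N) (fun w => trf f (X N w))
     <= K%:E * supnorm (cderive f) ^+ 2)%E.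
Local Notation C := R[i].
Local Notation E N Y := (Rintegral (P N) setT Y).
Local Notation S N h := (fun w => sum_eig h (X N w)).

Let X_herm N w : X N w \is hermsymmx. Proof. exact: (X_ens N).1.1. Qed.
Let X_mom N : finite_trace_moments (P N) (X N). Proof. exact: (X_ens N).2. Qed.
Arguments X_herm : clear implicits.
Arguments X_mom : clear implicits.
Let intS N h (th : tame h) := integ_sum_eig (X_herm N) (X_mom N) th.

Definition cov N (f g : R -> C) : C :=
  ccovariance (P N) (fun w => trf f (X N w)) (fun w => trf g (X N w)).

Lemma moment_bound h : tame h ->
  exists2 c : R, 0 <= c & \forall N \near \oo, E N (S N h) <= c * N%:R.
Proof.
move=> th; have [c [k [c0 hc]]] := tame_bound th.
(* Limits of moments are assumed for positive exponents, hence the successor; [sqr_exp_le] absorbs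
   the raised exponent at the cost of the factor 2. *)
pose m := (k.+1 * 2)%N.
have /ccvgP/(_ _ ltr01) ul : (fun N : nat => (N%:R)^-1 *
    cexpectation (P N) (fun w => \tr (X N w ^+ m)) : R[i]^o) @ \oo
    --> (alpha1 m : R[i]^o) by exact: lim_moments.
pose A := normc (alpha1 m) + 1; have A0 : 0 <= A by rewrite addr_ge0 ?normc_ge0.
exists (2 * c * (1 + A)); first by rewrite !mulr_ge0// addr_ge0.
near=> N; have N0 : (0 : R) < N%:R by rewrite ltr0n; near: N; exact: nbhs_infty_gt.
have EmA : E N (S N (fun x => x ^+ m)) <= A * N%:R.
  have : normc (N%:R^-1 * cexpectation (P N) (fun w => \tr (X N w ^+ m)) - alpha1 m) < 1.
    by near: N.
  move=> h1; have : normc (N%:R^-1 * cexpectation (P N) (fun w => \tr (X N w ^+ m))) <= A.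
    by rewrite -[X in normc X](subrK (alpha1 m)) (le_trans (normcD _ _))// addrC lerD2l ltW.
  have -> : N%:R^-1 = ((N%:R^-1 : R)%:C)%C :> C by rewrite fmorphV rmorph_nat.
  rewrite Normc.normcM normc_real ger0_norm ?invr_ge0// ler_pdivrMl// mulrC.
  apply: le_trans; apply: le_trans (normRe_le _); rewrite cexpectationE /=.
  apply: le_trans (ler_norm _); rewrite le_eqVlt; apply/orP; left; apply/eqP.
  by apply: eq_Rintegral => w _; rewrite tr_expmx.
have im := integ_sum_eig_exp (X_herm N) (X_mom N) m.
have ic := integ_cst (P N) N%:R.
apply: (@le_trans _ _ (E N (fun w => 2 * c * (N%:R + sum_eig (fun x => x ^+ m) (X N w))))).
  apply: mean_le => [||w]; [exact: intS|exact: integZ (integD ic im)|].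
  rewrite -sum_eig_growth; apply: sum_eig_le => x.
  rewrite (le_trans (ler_norm _))// (le_trans (hc x))// mulrAC mulrC.
  rewrite ler_wpM2r// (le_trans (lerD (lexx 1) (sqr_exp_le x k 1)))// addn1.
  by have := sqr_ge0 (x ^+ k.+1); lra.
rewrite (meanZ _ (integD ic im)) (meanD ic im) mean_cst -[leRHS]mulrA ler_wpM2l ?mulr_ge0//.
by rewrite mulrDl mul1r lerD2l.
Unshelve. all: by end_near. Qed.

Lemma sqr_moment_bound h : tame h ->
  exists2 c : R, 0 <= c &
    \forall N \near \oo, E N (fun w => sum_eig h (X N w) ^+ 2) <= c * N%:R ^+ 2.
Proof.
move=> th; have [c c0 hc] := moment_bound (tameX 2 th); exists c => //.
apply: filterS hc => N hN.
rewrite (le_trans (mean_sum_eig_sqr (X_herm N) (X_mom N) th))//.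
by rewrite expr2 mulrA mulrC ler_wpM2r.
Qed.

Lemma tail_prob (e : R) : 0 < e ->
  \forall N \near \oo, N%:R ^+ 8 * fine (P N (tail (X N) M)) < e.
Proof.
move=> e0; have /fine_cvg/cvgrPdist_lt/(_ e e0) := norm_tail.
apply: filterS => N /=; rewrite sub0r normrN => /(le_lt_trans (ler_norm _)).
rewrite fineM// fin_num_measure//.
exact: (measurable_tail (X_herm N) (X_mom N)).
Qed.

(** After squaring, [N ^+ 4] meets the [N ^+ 3] of [mean_tail] and the [N] of [moment_bound], which
    gives a constant times [N ^+ 8] times the tail probability. The factor [N ^+ 2] in the claim is
    reserved for the other function in the covariance. *)
Lemma tail_sqr_moment h (e : R) : 0 < e -> tame h ->
  (forall x, - M <= x <= M -> h x = 0) ->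
  \forall N \near \oo, N%:R ^+ 2 * E N (fun w => sum_eig h (X N w) ^+ 2) <= e.
Proof.
move=> e0 th h0; have [c c0 hc] := moment_bound (tameX 4 th).
have e1 : 0 < e ^+ 2 / (c + 1) by rewrite divr_gt0 ?exprn_gt0 ?ltr_wpDl.
near=> N.
have hN : E N (S N (fun x => h x ^+ 4)) <= c * N%:R by near: N.
have pN : N%:R ^+ 8 * fine (P N (tail (X N) M)) < e ^+ 2 / (c + 1).
  by near: N; exact: tail_prob.
have := mean_tail (X_herm N) (X_mom N) M_gt0 th h0.
set p := fine _ in pN *; set e2 := E N _; set e4 := E N _ in hN * => et.
have e20 : 0 <= e2 by exact: mean_sqr_ge0.
have p0 : 0 <= p by rewrite fine_ge0.
have n0 : (0 : R) <= N%:R by [].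
rewrite -(@ler_pXn2r _ 2) ?nnegrE ?mulr_ge0 ?exprn_ge0 ?(ltW e0)//.
rewrite exprMn -exprM (@le_trans _ _ (N%:R ^+ 4 * (p * (N%:R ^+ 3 * (c * N%:R)))))//.
  rewrite ler_wpM2l ?exprn_ge0// (le_trans et)// ler_wpM2l// ler_wpM2l// exprn_ge0//.
have -> : N%:R ^+ 4 * (p * (N%:R ^+ 3 * (c * N%:R))) = c * (N%:R ^+ 8 * p) by ring.
move: pN; rewrite ltr_pdivlMr ?ltr_wpDl// => pN.
have : 0 <= N%:R ^+ 8 * p by rewrite mulr_ge0 ?exprn_ge0.
by move: (N%:R ^+ 8 * p) pN => q; lra.
Unshelve. all: by end_near. Qed.

Let cL2t N f (tf : ctame f) := cL2_trf (X_herm N) (X_mom N) tf.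

Lemma cov_tail f g : ctame f -> ctame g -> (forall x, - M <= x <= M -> f x = 0) ->
  ccvg \oo (fun N => cov N f g) 0.
Proof.
move=> tf tg f0 e e0; have [c c0 hc] := sqr_moment_bound (tame_normc tg).
have e1 : 0 < e ^+ 2 / (c + 1) by rewrite divr_gt0 ?exprn_gt0 ?ltr_wpDl.
have nf0 x : - M <= x <= M -> normc (f x) = 0 by move=> /f0 ->; rewrite Normc.normc0.
near=> N; rewrite subr0.
have hg : E N (fun w => sum_eig (fun x => normc (g x)) (X N w) ^+ 2) <= c * N%:R ^+ 2.
  by near: N.
have hf : N%:R ^+ 2 * E N (fun w => sum_eig (fun x => normc (f x)) (X N w) ^+ 2) <=
    e ^+ 2 / (c + 1).
  by near: N; exact: tail_sqr_moment (tame_normc tf) nf0.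
rewrite -(@ltr_pXn2r _ 2) ?nnegrE ?normc_ge0 ?(ltW e0)//.
apply: le_lt_trans (ccovariance_cs (cL2t N tf) (cL2t N tg)) _.
have vf := real_cvariance_trf_le (X_herm N) (X_mom N) tf.
have vg := real_cvariance_trf_le (X_herm N) (X_mom N) tg.
apply: le_lt_trans (ler_pM _ _ vf (le_trans vg hg)) _; try exact: real_cvariance_ge0.
set ef := E N _ in hf *.
have -> : ef * (c * N%:R ^+ 2) = c * (N%:R ^+ 2 * ef) by ring.
move: hf; rewrite ler_pdivlMr ?ltr_wpDl//.
have : 0 <= N%:R ^+ 2 * ef by rewrite mulr_ge0 ?exprn_ge0//; exact: mean_sqr_ge0.
have : 0 < e ^+ 2 by rewrite exprn_gt0.
move: (N%:R ^+ 2 * ef) (e ^+ 2) => q s s0 q0 qs; have [q1|] := ltP 0 q; first by lra.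
by move=> q1; have -> : q = 0 by [lra]; rewrite mulr0.
Unshelve. all: by end_near. Qed.

Lemma trf_lin (a : C) f g n (A : 'M[C]_n) :
  trf (fun x => a * f x + g x) A = a * trf f A + trf g A.
Proof. by rewrite /trf mulr_sumr -big_split. Qed.

Lemma covC N f g : cov N f g = cov N g f.
Proof. exact: ccovarianceC. Qed.

Lemma cov_linl N (a : C) f g h : ctame f -> ctame g -> ctame h ->
  cov N (fun x => a * f x + g x) h = a * cov N f h + cov N g h.
Proof.
move=> tf tg th; rewrite /cov; under eq_fun do rewrite trf_lin.
by apply: ccovariance_linl; exact: cL2t.
Qed.

Lemma cov_linr N (a : C) f g h : ctame f -> ctame g -> ctame h ->
  cov N h (fun x => a * f x + g x) = a * cov N h f + cov N h g.
Proof. by move=> tf tg th; rewrite covC cov_linl// !(covC N h). Qed.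

(** Pointwise majorants [a] and [b] replace [supnorm], which may be infinite, and confine the
    extended reals to this proof. *)
Lemma cov_bound N f g a b : C1 f -> C1 g -> ctame f -> ctame g ->
  (forall x, normc (cderive f x) <= a) -> (forall x, normc (cderive g x) <= b) ->
  normc (cov N f g) <= K * a * b.
Proof.
move=> cf cg tf tg fa gb.
have a0 : 0 <= a := le_trans (normc_ge0 _) (fa 0).
have b0 : 0 <= b := le_trans (normc_ge0 _) (gb 0).
have vb (h : R -> C) r : C1 h -> ctame h -> 0 <= r -> (forall x, normc (cderive h x) <= r) ->
    real_cvariance (P N) (fun w => trf h (X N w)) <= K * r ^+ 2.
  move=> ch th r0 hr; have := var_bound N ch; rewrite (cvarianceE (cL2t N th)) => vK.
  rewrite -lee_fin (le_trans vK)// EFinM; apply: lee_wpmul2l; first by rewrite lee_fin ltW.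
  have s0 : (0 <= supnorm (cderive h))%E.
    apply: le_trans (ereal_sup_ubound _); last by exists 0.
    by rewrite lee_fin normc_ge0.
  have sr : (supnorm (cderive h) <= r%:E)%E.
    by apply: ge_ereal_sup => _ [x _ <-]; rewrite lee_fin.
  by rewrite expe2 expr2 EFinM; exact: lee_pmul.
rewrite -(@ler_pXn2r _ 2) ?nnegrE ?normc_ge0 ?mulr_ge0 ?(ltW K_gt0)//.
apply: le_trans (ccovariance_cs (cL2t N tf) (cL2t N tg)) _.
apply: le_trans (ler_pM _ _ (vb f a cf tf a0 fa) (vb g b cg tg b0 gb)) _.
1,2: exact: real_cvariance_ge0.
by rewrite le_eqVlt; apply/orP; left; apply/eqP; ring.
Qed.

Lemma cov_limsup f g a b (e : R) : classS f -> classS g ->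
  (forall x, - M <= x <= M -> normc (cderive f x) <= a) ->
  (forall x, - M <= x <= M -> normc (cderive g x) <= b) -> 0 < e ->
  \forall N \near \oo, normc (cov N f g) <= K * a * b + e.
Proof.
move=> /classSP[cf tf] /classSP[cg tg] fa gb e0.
have [f1 [/classSP[cf1 tf1] ff1 _ df1]] := C1_extension M_gt0 cf.
have [g1 [/classSP[cg1 tg1] gg1 _ dg1]] := C1_extension M_gt0 cg.
have e2 : 0 < e / 2 by rewrite divr_gt0.
have sub0 (h h1 : R -> C) : (forall x, - M <= x <= M -> h1 x = h x) ->
    forall x, - M <= x <= M -> -1 * h1 x + h x = 0.
  by move=> hh1 x /hh1 ->; rewrite mulN1r addNr.
have tsub (h h1 : R -> C) : ctame h -> ctame h1 -> ctame (fun x => -1 * h1 x + h x).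
  by move=> th th1; exact: ctame_lin.
have c1 := cov_tail (tsub _ _ tf tf1) tg (sub0 _ _ ff1).
have c2 := cov_tail (tsub _ _ tg tg1) tf1 (sub0 _ _ gg1).
near=> N.
have h1 : normc (cov N (fun x => -1 * f1 x + f x) g - 0) < e / 2 by near: N; exact: c1.
have h2 : normc (cov N (fun x => -1 * g1 x + g x) f1 - 0) < e / 2 by near: N; exact: c2.
have h3 : normc (cov N f1 g1) <= K * a * b.
  apply: cov_bound => // x.
    by have [t tM ->] := df1 x; exact: fa.
  by have [t tM ->] := dg1 x; exact: gb.
(* The arguments are exchanged one at a time: [f] for [f1] against [g], then [g] for [g1] against
   [f1]. Both differences vanish on [[-M, M]]. *)
have -> : cov N f g = cov N f1 g1 + (cov N (fun x => -1 * f1 x + f x) g +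
    cov N (fun x => -1 * g1 x + g x) f1).
  rewrite !cov_linl// (covC N g f1) (covC N g1 f1); ring.
rewrite !subr0 in h1 h2.
rewrite (le_trans (normcD _ _))// lerD// (le_trans (normcD _ _))//; lra.
Unshelve. all: by end_near. Qed.

End Ensemble.

(** * The limit form *)

Section LimitForm.
Context (R : realType) (M K : R).
Local Notation C := R[i].
Hypotheses (M_gt0 : 0 < M) (K_gt0 : 0 < K).
(** Probability enters this section only through the five properties below; [c] stands for the
    covariance at size [N]. *)
Context (c : nat -> (R -> C) -> (R -> C) -> C) (rho : {poly C} -> {poly C} -> C).
Hypothesis c_sym : forall N f g, c N f g = c N g f.
Hypothesis c_linl : forall N (a : C) f g h, classS f -> classS g -> classS h ->
  c N (fun x => a * f x + g x) h = a * c N f h + c N g h.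
Hypothesis c_limsup : forall f g a b (e : R), classS f -> classS g ->
  (forall x, - M <= x <= M -> normc (cderive f x) <= a) ->
  (forall x, - M <= x <= M -> normc (cderive g x) <= b) -> 0 < e ->
  \forall N \near \oo, normc (c N f g) <= K * a * b + e.
Hypothesis c_tail : forall f g, classS f -> classS g ->
  (forall x, - M <= x <= M -> f x = 0) -> ccvg \oo (fun N => c N f g) 0.
Hypothesis c_poly : forall p q, ccvg \oo (fun N => c N (poly_fun p) (poly_fun q)) (rho p q).

Lemma c_linr N (a : C) f g h : classS f -> classS g -> classS h ->
  c N h (fun x => a * f x + g x) = a * c N h f + c N h g.
Proof. by move=> Sf Sg Sh; rewrite c_sym c_linl// !(c_sym N h). Qed.

Lemma le_seg_ge0 (h : R -> C) (a : R) :
  (forall x, - M <= x <= M -> normc (h x) <= a) -> 0 <= a.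
Proof. by move=> ha; apply: le_trans (normc_ge0 (h 0)) (ha _ _); rewrite oppr_le0 !(ltW M_gt0). Qed.

Lemma cvg_c f g : classS f -> classS g -> exists l, ccvg \oo (fun N => c N f g) l.
Proof.
move=> Sf Sg; apply: ccvg_approx => e e0.
pose a := supnorm_seg M (cderive f); pose b := supnorm_seg M (cderive g).
have fa x : - M <= x <= M -> normc (cderive f x) <= a by exact: le_supnorm_seg Sf.1.
have gb x : - M <= x <= M -> normc (cderive g x) <= b by exact: le_supnorm_seg Sg.1.
have a0 := le_seg_ge0 fa; have b0 := le_seg_ge0 gb.
pose D := K * (a + b + 1); have D0 : 0 < D by rewrite mulr_gt0//; lra.
(* Accuracy at most 1 keeps the derivative of [p] below [a + 1]. Replacing [f] by [p], then [g] by
   [q], costs [K * t * b + K * (a + 1) * t = t * D], at most [e / 2]; the two margins [e / 4] use up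
   the rest. *)
pose t := Num.min 1 (e / 2 / D).
have t0 : 0 < t by rewrite lt_min ltr01 !divr_gt0.
have t1 : t <= 1 by rewrite ge_min lexx.
have tD : t * D <= e / 2 by rewrite -ler_pdivlMr// ge_min lexx orbT.
have [p hp] := C1_weierstrass M_gt0 t0 Sf.1.
have [q hq] := C1_weierstrass M_gt0 t0 Sg.1.
have Sp := classS_poly p; have Sq := classS_poly q.
exists (fun N => c N (poly_fun p) (poly_fun q)), (rho p q); split; first exact: c_poly.
have Sfp := classS_lin (-1) Sp Sf; have Sgq := classS_lin (-1) Sq Sg.
have dfp x : - M <= x <= M -> normc (cderive (fun x => -1 * poly_fun p x + f x) x) <= t.
  by rewrite (C1_lin (-1) Sp.1 Sf.1).2 mulN1r addrC; exact: hp.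
have dgq x : - M <= x <= M -> normc (cderive (fun x => -1 * poly_fun q x + g x) x) <= t.
  by rewrite (C1_lin (-1) Sq.1 Sg.1).2 mulN1r addrC; exact: hq.
have dp x : - M <= x <= M -> normc (cderive (poly_fun p) x) <= a + 1.
  move=> xM; rewrite -[cderive (poly_fun p) x](subKr (cderive f x)).
  by rewrite (le_trans (normcB _ _))// lerD ?fa// (le_trans (hp x xM)).
have e4 : 0 < e / 4 by rewrite divr_gt0.
near=> N.
have h1 : normc (c N (fun x => -1 * poly_fun p x + f x) g) <= K * t * b + e / 4.
  by near: N; exact: c_limsup.
have h2 : normc (c N (poly_fun p) (fun x => -1 * poly_fun q x + g x)) <= K * (a + 1) * t + e / 4.
  by near: N; exact: c_limsup.
rewrite c_linl// in h1; rewrite c_linr// in h2.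
have -> : c N f g - c N (poly_fun p) (poly_fun q) =
    -1 * c N (poly_fun p) g + c N f g +
    (-1 * c N (poly_fun p) (poly_fun q) + c N (poly_fun p) g) by ring.
rewrite (le_trans (normcD _ _))//.
have : t * D = K * t * b + K * (a + 1) * t by rewrite /D; ring.
lra.
Unshelve. all: by end_near. Qed.

Definition limform f g : C := xget 0 [set l | ccvg \oo (fun N => c N f g) l].

Lemma limformP f g : classS f -> classS g -> ccvg \oo (fun N => c N f g) (limform f g).
Proof. by move=> Sf Sg; have [l cl] := cvg_c Sf Sg; exact: (xgetI 0 cl). Qed.

Lemma limform_eq f g l : classS f -> classS g ->
  ccvg \oo (fun N => c N f g) l -> limform f g = l.
Proof. by move=> Sf Sg; apply: ccvg_unique; exact: limformP. Qed.

Lemma limform_sym f g : limform f g = limform g f.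
Proof. by rewrite /limform; under eq_fun do under eq_fun do rewrite c_sym. Qed.

Lemma limform_linl (a : C) f g h : classS f -> classS g -> classS h ->
  limform (fun x => a * f x + g x) h = a * limform f h + limform g h.
Proof.
move=> Sf Sg Sh; apply: limform_eq => //; first exact: classS_lin.
by under eq_fun do rewrite c_linl//; apply: ccvg_lin; exact: limformP.
Qed.

Lemma limform_linr (a : C) f g h : classS f -> classS g -> classS h ->
  limform h (fun x => a * f x + g x) = a * limform h f + limform h g.
Proof. by move=> Sf Sg Sh; rewrite limform_sym limform_linl// !(limform_sym h). Qed.

Lemma limform_bound f g a b : classS f -> classS g ->
  (forall x, - M <= x <= M -> normc (cderive f x) <= a) ->
  (forall x, - M <= x <= M -> normc (cderive g x) <= b) ->
  normc (limform f g) <= K * a * b.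
Proof.
move=> Sf Sg fa gb; apply: (ccvg_le (limformP Sf Sg)) => e e0.
exact: c_limsup.
Qed.

(** Here the tail estimate makes the limit a function of restrictions to [[-M, M]]. *)
Lemma limform_eql f1 f2 g : classS f1 -> classS f2 -> classS g ->
  (forall x, - M <= x <= M -> f1 x = f2 x) -> limform f1 g = limform f2 g.
Proof.
move=> S1 S2 Sg f12; apply: limform_eq => //; apply: ccvg_eq (limformP S2 Sg) _.
have := @c_tail (fun x => -1 * f2 x + f1 x) g (classS_lin (-1) S2 S1) Sg.
under eq_fun do rewrite c_linl// mulN1r addrC.
by apply => x xM; rewrite f12// mulN1r addNr.
Qed.

Lemma limform_eq2 f1 f2 g1 g2 : classS f1 -> classS f2 -> classS g1 -> classS g2 ->
  (forall x, - M <= x <= M -> f1 x = f2 x) ->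
  (forall x, - M <= x <= M -> g1 x = g2 x) -> limform f1 g1 = limform f2 g2.
Proof.
move=> Sf1 Sf2 Sg1 Sg2 f12 g12; rewrite (limform_eql Sf1 Sf2)//.
by rewrite limform_sym (limform_eql Sg1 Sg2)// limform_sym.
Qed.

(** Covariances need functions on the line, whereas the extended form acts on restrictions. Some
    representative in the class is chosen; by [limform_eq2] the choice does not affect the limit. *)
Definition lift_seg (F : seg M -> C) : R -> C :=
  xget (fun=> 0) [set f | classS f /\ restr f = F].

Definition segform (F G : seg M -> C) : C := limform (lift_seg F) (lift_seg G).

Lemma restr_eqP (f g : R -> C) : restr (M:=M) f = restr g <->
  forall x, - M <= x <= M -> f x = g x.
Proof.
split=> [fg x xM|fg].
  have xM' : x \in `[- M, M] by rewrite in_itv.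
  exact: (congr1 (fun h => h (exist (fun y => y \in `[- M, M]) x xM')) fg).
by apply/funext => -[x xM]; rewrite /restr/=; apply: fg; move: xM; rewrite in_itv.
Qed.

Lemma lift_segP f : C1 f -> classS (lift_seg (restr f)) /\
  forall x, - M <= x <= M -> lift_seg (restr f) x = f x.
Proof.
move=> Cf; have [f1 [Sf1 ff1 _ _]] := C1_extension M_gt0 Cf.
rewrite -restr_eqP.
exact: (@xgetPex _ (fun=> 0) [set h | classS h /\ restr (M:=M) h = restr f]
  (ex_intro _ f1 (conj Sf1 ((restr_eqP f1 f).2 ff1)))).
Qed.

Lemma segformE f g f1 g1 : C1 f -> C1 g -> classS f1 -> classS g1 ->
  (forall x, - M <= x <= M -> f1 x = f x) -> (forall x, - M <= x <= M -> g1 x = g x) ->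
  segform (restr f) (restr g) = limform f1 g1.
Proof.
move=> Cf Cg Sf1 Sg1 ff1 gg1; have [Sf hf] := lift_segP Cf.
have [Sg hg] := lift_segP Cg; apply: limform_eq2 => // x xM.
  by rewrite hf// ff1.
by rewrite hg// gg1.
Qed.

Lemma segform_poly p q : segform (restr (poly_fun p)) (restr (poly_fun q)) = rho p q.
Proof.
have Sp := classS_poly p; have Sq := classS_poly q.
rewrite (segformE Sp.1 Sq.1 Sp Sq)//; exact: limform_eq.
Qed.

Lemma segform_bound f g : C1 f -> C1 g ->
  normc (segform (restr f) (restr g)) <=
    K * supnorm_seg M (cderive f) * supnorm_seg M (cderive g).
Proof.
move=> Cf Cg; have [f1 [Sf1 ff1 df1 _]] := C1_extension M_gt0 Cf.
have [g1 [Sg1 gg1 dg1 _]] := C1_extension M_gt0 Cg.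
rewrite (segformE Cf Cg Sf1 Sg1)//; apply: limform_bound => // x xM.
  by rewrite df1//; exact: le_supnorm_seg.
by rewrite dg1//; exact: le_supnorm_seg.
Qed.

Lemma segform_bilinear : bilinear_on (C1seg (M:=M)) segform.
Proof.
have restr_lin (a : C) (f g : R -> C) : (fun x => a * restr f x + restr g x) =
  restr (M:=M) (fun x => a * f x + g x) by [].
split=> a _ _ _ [f Cf <-] [g Cg <-] [h Ch <-].
  have [f1 [Sf1 ff1 _ _]] := C1_extension M_gt0 Cf.
  have [g1 [Sg1 gg1 _ _]] := C1_extension M_gt0 Cg.
  have [h1 [Sh1 hh1 _ _]] := C1_extension M_gt0 Ch.
  rewrite restr_lin (segformE Cf Ch Sf1 Sh1)// (segformE Cg Ch Sg1 Sh1)//.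
  rewrite -(limform_linl a Sf1 Sg1 Sh1).
  apply: (segformE (C1_lin a Cf Cg).1 Ch (classS_lin a Sf1 Sg1) Sh1) => // x xM.
  by rewrite (ff1 x xM) (gg1 x xM).
have [f1 [Sf1 ff1 _ _]] := C1_extension M_gt0 Cf.
have [g1 [Sg1 gg1 _ _]] := C1_extension M_gt0 Cg.
have [h1 [Sh1 hh1 _ _]] := C1_extension M_gt0 Ch.
rewrite restr_lin (segformE Cf Ch Sf1 Sh1)// (segformE Cf Cg Sf1 Sg1)//.
rewrite -(limform_linr a Sg1 Sh1 Sf1).
apply: (segformE Cf (C1_lin a Cg Ch).1 Sf1 (classS_lin a Sg1 Sh1)) => // x xM.
by rewrite (gg1 x xM) (hh1 x xM).
Qed.

Lemma segform_cvg f g : classS f -> classS g ->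
  ccvg \oo (fun N => c N f g) (segform (restr f) (restr g)).
Proof.
by move=> Sf Sg; rewrite (segformE Sf.1 Sg.1 Sf Sg)//; exact: limformP.
Qed.

End LimitForm.

(** * Frechet integral representation *)

Section Ramp.
Variables (R : realType) (M : R).
Implicit Types (k x y t : R).

(** The positive part is written as a splice, so that [C1_splice] provides its primitive. *)
Definition pospart t : R := splice 0 (fun=> 0) id t.

Definition pospart_prim t : R := splice 0 (fun=> 0) (fun t => t ^+ 2 / 2) t.

Lemma C1_pospart_prim : C1_with pospart_prim pospart.
Proof.
apply: C1_splice => //=; last by rewrite expr0n mul0r.
  by split=> x; [exact: is_derive_cst|exact: cvg_cst].
split=> x; last exact: cvg_id.
by apply: is_derive_eq; rewrite /GRing.scale/=; field.
Qed.

Lemma C1_with_affine (h h' : R -> R) (a b : R) : C1_with h h' ->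
  C1_with (fun y => h (a * y + b)) (fun y => a * h' (a * y + b)).
Proof.
move=> [dh ch]; split=> y.
  have da : is_derive y 1 (fun y => a * y + b) a.
    by apply: is_derive_eq; rewrite /GRing.scale/=; ring.
  rewrite mulrC.
  exact: (@is_derive1_comp _ h (fun y => a * y + b) y _ _ (dh (a * y + b)) da).
apply: cvgM; first exact: cvg_cst.
apply: (@continuous_comp _ _ _ (fun y : R => a * y + b) h'); last exact: ch.
by apply: cvgD; [apply: cvgM; [exact: cvg_cst|exact: cvg_id]|exact: cvg_cst].
Qed.

(* A continuous approximation of the indicator of [-M, x]; at [x = -M] it is 0,
   so that the increments over a partition of [-M, M] add up to 1. *)
Definition ramp k x y : R :=
  if x <= - M then 0 else pospart (k * (x - y) + 1) - pospart (k * (x - y)).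

(** Integrating functions of [k * (x - y)] in [y] produces the factor [- k^-1]; the arguments are in
    the form [a * y + b] of [C1_with_affine]. *)
Definition ramp_prim k x y : R :=
  if x <= - M then 0 else
  - k^-1 * pospart_prim ((- k) * y + (k * x + 1)) + k^-1 * pospart_prim ((- k) * y + k * x).

Lemma C1_ramp_prim k x : 0 < k -> C1_with (ramp_prim k x) (ramp k x).
Proof.
move=> k0; rewrite /ramp_prim /ramp; have [_|_] := boolP (x <= - M).
  by split=> y; [exact: is_derive_cst|exact: cvg_cst].
have c1 := C1_withZ (- k^-1) (C1_with_affine (- k) (k * x + 1) C1_pospart_prim).
have c2 := C1_withZ (k^-1) (C1_with_affine (- k) (k * x) C1_pospart_prim).
have := C1_withD c1 c2; congr C1_with; apply/funext => y.
have nk : k != 0 by rewrite lt0r_neq0.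
rewrite (mulrA (- k^-1)) (mulrA k^-1) mulrNN mulrN (mulVf nk) mul1r mulN1r.
by congr (pospart _ - pospart _); ring.
Qed.

Lemma tame_ramp_prim k x : 0 < k -> tame (ramp_prim k x).
Proof.
move=> k0; have cr := C1_with_continuous (C1_ramp_prim x k0).
have ta (a b : R) : tame (fun y => a * y + b).
  exact: (tameD (tameZ a (@tame_id R)) (tame_cst b)).
have pp t : `|pospart_prim t| <= t ^+ 2.
  rewrite /pospart_prim /splice; case: ifP => _; first by rewrite normr0 sqr_ge0.
  by rewrite ger0_norm ?divr_ge0 ?sqr_ge0//; have := sqr_ge0 t; lra.
apply: (@tame_le _ _ (fun y => k^-1 * ((- k) * y + (k * x + 1)) ^+ 2 +
   k^-1 * ((- k) * y + k * x) ^+ 2)) => //.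
  by apply: tameD; apply: tameZ; apply: tameX.
have ki : 0 <= k^-1 by rewrite invr_ge0 ltW.
move=> y; rewrite /ramp_prim; case: ifP => _; first by rewrite normr0.
apply: le_trans (ler_norm _); rewrite (le_trans (ler_normD _ _))//.
by rewrite !normrM normrN (ger0_norm ki) lerD// ler_wpM2l.
Qed.

Lemma pospartE t : pospart t = Num.max t 0.
Proof. by rewrite /pospart /splice maxC maxElt ltNge; case: ifP. Qed.

Lemma ramp_le x x' k y : 0 < k -> x <= x' -> ramp k x y <= ramp k x' y.
Proof.
move=> k0 xx; have kxx : k * (x - y) <= k * (x' - y) by rewrite ler_pM2l// lerD2r.
rewrite /ramp; have [xM|xM] := leP x (- M).
  case: ifP => _ //; rewrite subr_ge0 !pospartE; move: (k * _) => t.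
  by rewrite ge_max le_max lerDl ler01/= le_max lexx orbT.
rewrite ifF; last by apply/negbTE; rewrite -ltNge (lt_le_trans xM).
move: (k * _) (k * _) kxx => t t' tt; rewrite !pospartE.
case: (leP t 0); case: (leP (t + 1) 0); case: (leP t' 0); case: (leP (t' + 1) 0); lra.
Qed.

Lemma ramp_right k x y : 0 < k -> - M < x -> y <= x -> ramp k x y = 1.
Proof.
move=> k0 Mx yx; rewrite /ramp ifF; last by apply/negbTE; rewrite -ltNge.
have : 0 <= k * (x - y) by rewrite mulr_ge0 ?subr_ge0// ltW.
move: (k * _) => t t0; rewrite !pospartE; case: (leP t 0); case: (leP (t + 1) 0); lra.
Qed.

Lemma ramp_low k x y : x <= - M -> ramp k x y = 0.
Proof. by rewrite /ramp => ->. Qed.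

Lemma ramp_left k x y : 0 < k -> x + k^-1 <= y -> ramp k x y = 0.
Proof.
move=> k0 xy; rewrite /ramp; case: ifP => // _.
have : k * (x - y) <= -1.
  by rewrite -ler_pdivlMl// mulrN1; lra.
move: (k * _) => t t0; rewrite !pospartE; case: (leP t 0); case: (leP (t + 1) 0); lra.
Qed.

Lemma ramp_norm k x y : 0 < k -> `|ramp k x y| <= 1.
Proof.
move=> k0; rewrite /ramp; case: ifP => _; first by rewrite normr0.
move: (k * _) => t; rewrite !pospartE ler_norml.
case: (leP t 0); case: (leP (t + 1) 0); lra.
Qed.

End Ramp.

(** * Ramp increments as a partition of unity *)

Section Partition.
Variables (R : realType) (M : R).
Local Notation C := R[i].
Hypothesis M_gt0 : 0 < M.

Lemma partition_in m (s : nat -> R) i : is_partition M m s -> (i <= m)%N ->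
  - M <= s i <= M.
Proof.
move=> [s0 sm smon] im; rewrite -{1}s0 -sm.
have mono j k : (j <= k)%N -> (k <= m)%N -> s j <= s k.
  elim: k => [|k IH]; first by rewrite leqn0 => /eqP ->.
  rewrite leq_eqVlt => /orP[/eqP -> //|jk] km.
  exact: le_trans (IH jk (ltnW km)) (smon k km).
by rewrite !mono.
Qed.

Lemma tag_in m (s xi : nat -> R) i : is_partition M m s -> is_tagging m s xi ->
  (i < m)%N -> - M <= xi i <= M.
Proof.
move=> ps tx im; have /andP[x1 x2] := tx i im.
have /andP[s1 _] := partition_in ps (ltnW im); have /andP[_ s2] := partition_in ps im.
by rewrite (le_trans s1 x1) (le_trans x2 s2).
Qed.

Definition ramp_incr k (s : nat -> R) i y := ramp M k (s i.+1) y - ramp M k (s i) y.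

Lemma ramp_incr_ge0 k m s i y : 0 < k -> is_partition M m s -> (i < m)%N ->
  0 <= ramp_incr k s i y.
Proof. by move=> k0 [_ _ smon] im; rewrite subr_ge0; apply: ramp_le => //; exact: smon. Qed.

Lemma sum_ramp_incr k m s y : 0 < k -> is_partition M m s -> y <= M ->
  \sum_(i < m) ramp_incr k s i y = 1.
Proof.
move=> k0 [s0 sm _] yM; rewrite -(big_mkord xpredT (fun i => ramp_incr k s i y)).
rewrite (telescope_sumr_eq (fun i => ramp M k (s i) y))//.
by rewrite s0 sm (@ramp_low _ _ _ (- M))// subr0 ramp_right// gtrN.
Qed.

(** For [y < s i] both ramps equal 1, and for [y > s i.+1 + k^-1] both vanish. The bound [- M <= y]
    keeps the first case clear of the cut-off at [- M]. *)
Lemma ramp_incr_supp k m s i y xi : 0 < k -> is_partition M m s -> (i < m)%N ->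
  - M <= y -> s i <= xi <= s i.+1 -> ramp_incr k s i y != 0 ->
  `|xi - y| <= mesh m s + k^-1.
Proof.
move=> k0 ps im My /andP[sxi xis] nz.
have si : s i <= s i.+1 by case: ps => _ _; exact.
have sy : s i <= y.
  rewrite leNgt; apply/negP => ys; move/eqP: nz; apply.
  by rewrite /ramp_incr !ramp_right ?subrr//; lra.
have ys : y <= s i.+1 + k^-1.
  rewrite leNgt; apply/negP => ys; move/eqP: nz; apply.
  by rewrite /ramp_incr !ramp_left ?subrr//; lra.
have : s i.+1 - s i <= mesh m s.
  exact: (le_bigmax _ (fun i : 'I_m => s i.+1 - s i) (Ordinal im)).
have : 0 < k^-1 by rewrite invr_gt0.
by rewrite ler_norml; lra.
Qed.

(** At [y] the sum is a convex combination of the [a i] with nonzero weight. It is used with [z = 0]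
    for bounds and with [z] the value of a derivative at [y] for approximation. *)
Lemma ramp_comb_approx k m s y (a : nat -> C) (z : C) (e : R) :
  0 < k -> is_partition M m s -> y <= M ->
  (forall i, (i < m)%N -> ramp_incr k s i y != 0 -> normc (a i - z) <= e) ->
  normc (\sum_(i < m) a i * (ramp_incr k s i y)%:C%C - z) <= e.
Proof.
move=> k0 ps yM ae.
have -> : \sum_(i < m) a i * (ramp_incr k s i y)%:C%C - z =
    \sum_(i < m) (a i - z) * (ramp_incr k s i y)%:C%C.
  under [RHS]eq_bigr do rewrite mulrBl.
  by rewrite sumrB -mulr_sumr -(rmorph_sum (real_complex R)) /= sum_ramp_incr// mulr1.
rewrite (le_trans (normc_sum _ _))//.
rewrite -[leRHS]mulr1 -(sum_ramp_incr k0 ps yM) mulr_sumr; apply: ler_sum => i _.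
rewrite Normc.normcM normc_real (ger0_norm (ramp_incr_ge0 _ k0 ps (ltn_ord i))).
have [->|nz] := eqVneq (ramp_incr k s i y) 0; first by rewrite !mulr0.
by rewrite ler_wpM2r ?(ramp_incr_ge0 _ k0 ps)// ae.
Qed.

End Partition.

Section UltraLimit.
Variable R : realType.

(* Taking all limits along one ultrafilter replaces a diagonal extraction over
   the uncountably many points [(x, y)] at which [u] has to be defined. *)
Lemma ultralimit : exists U : set_system nat, [/\ ProperFilter U, \oo `<=` U &
  forall (v : nat -> R) (B : R), (forall n, `|v n| <= B) ->
    exists l, forall e, 0 < e -> \forall n \near U, `|v n - l| < e].
Proof.
have [U [UU ooU]] := ultraFilterLemma (eventually_filter).
have PU : ProperFilter U by exact: ultra_proper.
exists U; split => // v B vB.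
have FF : ProperFilter (v @ U) by exact: fmap_proper_filter.
have [|l [_ cl]] := @segment_compact R (- B) B (v @ U) FF.
  have UB : U [set n | - B <= v n <= B].
    by apply: filterS (@filterT _ U _) => n _ /=; rewrite -ler_norml.
  suff : U (v @^-1` `[- B, B]) by [].
  by apply: filterS UB => n /=; rewrite in_itv.
(* An ultrafilter contains the set of indices with [v n] near [l] or its complement; the complement
   would contradict that [l] is a cluster point. *)
exists l => e e0; have [//|nA] := in_ultra_setVsetC [set n | `|v n - l| < e] UU.
have [|x []] := cl (~` [set x | `|x - l| < e]) (ball l e) _ (nbhsx_ballx _ _ e0).
  suff : U (v @^-1` (~` [set x | `|x - l| < e])) by [].
  by apply: filterS nA.
by move=> nx; rewrite /ball/= distrC.
Qed.

End UltraLimit.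

(** * From a bounded bilinear form to a Frechet integral *)

Section Frechet.
Context (R : realType) (M K : R).
Local Notation C := R[i].
Hypotheses (M_gt0 : 0 < M) (K_gt0 : 0 < K).
Context (L : (R -> C) -> (R -> C) -> C).
Hypothesis L_linl : forall (a : C) f g h, classS f -> classS g -> classS h ->
  L (fun x => a * f x + g x) h = a * L f h + L g h.
Hypothesis L_linr : forall (a : C) f g h, classS f -> classS g -> classS h ->
  L h (fun x => a * f x + g x) = a * L h f + L h g.
Hypothesis L_bound : forall f g a b, classS f -> classS g ->
  (forall x, - M <= x <= M -> normc (cderive f x) <= a) ->
  (forall x, - M <= x <= M -> normc (cderive g x) <= b) ->
  normc (L f g) <= K * a * b.
Hypothesis L_real : forall f g, classS f -> classS g ->
  (forall x, complex.Im (f x) = 0) -> (forall x, complex.Im (g x) = 0) ->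
  complex.Im (L f g) = 0.

Definition comb m (a : nat -> C) (f : nat -> R -> C) : R -> C :=
  fun x => \sum_(i < m) a i * f i x.

Lemma comb0 a f : comb 0 a f = fun=> 0.
Proof. by apply/funext => x; rewrite /comb big_ord0. Qed.

Lemma classS0 : classS (fun=> 0 : C).
Proof.
have := @classS_poly R 0; congr classS; apply/funext => x.
exact: horner0.
Qed.

Lemma cderive0 : cderive (fun=> 0 : C) = (fun=> 0) :> (R -> C).
Proof. by apply/funext => x; rewrite /cderive !derive1E !derive_cst. Qed.

Lemma combS m a f : comb m.+1 a f = fun x => a m * f m x + comb m a f x.
Proof. by apply/funext => x; rewrite /comb big_ord_recr/= addrC. Qed.

Lemma classS_comb m a f : (forall i, classS (f i)) -> classS (comb m a f).
Proof.
move=> Sf; elim: m => [|m IH]; first by rewrite comb0; exact: classS0.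
by rewrite combS; exact: classS_lin.
Qed.

Lemma cderive_comb m a f : (forall i, classS (f i)) ->
  cderive (comb m a f) = comb m a (fun i => cderive (f i)).
Proof.
move=> Sf; elim: m => [|m IH]; first by rewrite !comb0 cderive0.
by rewrite combS (C1_lin (a m) (Sf m).1 (classS_comb m a Sf).1).2 IH combS.
Qed.

Lemma L0l g : classS g -> L (fun=> 0) g = 0.
Proof.
move=> Sg; have := L_linl (-1) classS0 classS0 Sg.
rewrite (_ : (fun x : R => -1 * 0 + 0) = (fun=> 0 : C)).
  by move=> ->; rewrite mulN1r addNr.
by apply/funext => x; rewrite mulr0 addr0.
Qed.

Lemma L0r g : classS g -> L g (fun=> 0) = 0.
Proof.
move=> Sg; have := L_linr (-1) classS0 classS0 Sg.
rewrite (_ : (fun x : R => -1 * 0 + 0) = (fun=> 0 : C)).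
  by move=> ->; rewrite mulN1r addNr.
by apply/funext => x; rewrite mulr0 addr0.
Qed.

Lemma L_combl m a f g : (forall i, classS (f i)) -> classS g ->
  L (comb m a f) g = \sum_(i < m) a i * L (f i) g.
Proof.
move=> Sf Sg; elim: m => [|m IH]; first by rewrite comb0 L0l// big_ord0.
by rewrite combS L_linl ?IH ?big_ord_recr//= 1?addrC//; exact: classS_comb.
Qed.

Lemma L_combr m a f g : (forall i, classS (f i)) -> classS g ->
  L g (comb m a f) = \sum_(i < m) a i * L g (f i).
Proof.
move=> Sf Sg; elim: m => [|m IH]; first by rewrite comb0 L0r// big_ord0.
by rewrite combS L_linr ?IH ?big_ord_recr//= 1?addrC//; exact: classS_comb.
Qed.

Lemma L_comb m n a b f g : (forall i, classS (f i)) -> (forall j, classS (g j)) ->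
  L (comb m a f) (comb n b g) = \sum_(i < m) \sum_(j < n) a i * b j * L (f i) (g j).
Proof.
move=> Sf Sg; rewrite L_combl//; last exact: classS_comb.
apply: eq_bigr => i _; rewrite L_combr// mulr_sumr; apply: eq_bigr => j _.
by rewrite mulrA.
Qed.

Definition ramp_fun (k x : R) : R -> C := fun y => ((ramp_prim M k x y)%:C)%C.

Lemma ramp_funP k x : 0 < k -> classS (ramp_fun k x) /\
  cderive (ramp_fun k x) = fun y => ((ramp M k x y)%:C)%C.
Proof.
move=> k0; have [|c0 e] := @C1_of_parts _ (ramp_fun k x) _ (fun=> 0) (C1_ramp_prim M x k0).
  by split=> y; [exact: is_derive_cst|exact: cvg_cst].
split => //; apply/classSP; split => //; split; first exact: tame_ramp_prim.
exact: tame_cst.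
Qed.

(** The difference has the shape [a * f + g] in which linearity of [L] is stated. *)
Definition ramp_step k (s : nat -> R) i : R -> C :=
  fun y => -1 * ramp_fun k (s i) y + ramp_fun k (s i.+1) y.

Lemma ramp_stepP k s i : 0 < k -> classS (ramp_step k s i) /\
  cderive (ramp_step k s i) = fun y => ((ramp_incr M k s i y)%:C)%C.
Proof.
move=> k0; have [S0 d0] := ramp_funP (s i) k0; have [S1 d1] := ramp_funP (s i.+1) k0.
split; first exact: classS_lin.
rewrite (C1_lin (-1) S0.1 S1.1).2 d0 d1; apply/funext => y.
by rewrite /ramp_incr mulN1r addrC rmorphB.
Qed.

Definition approx_u k x y : R := complex.Re (L (ramp_fun k x) (ramp_fun k y)).

Lemma approx_uE k x y : 0 < k ->
  L (ramp_fun k x) (ramp_fun k y) = ((approx_u k x y)%:C)%C.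
Proof.
move=> k0; have [Sx _] := ramp_funP x k0; have [Sy _] := ramp_funP y k0.
have := L_real Sx Sy (fun=> erefl) (fun=> erefl).
by rewrite /approx_u; case: (L _ _) => a b /= ->.
Qed.

(** The bound is uniform in the slope because ramps have modulus at most 1; this is what a limit
    along the ultrafilter requires. *)
Lemma approx_u_le k x y : 0 < k -> `|approx_u k x y| <= K.
Proof.
move=> k0; rewrite -normc_real -approx_uE// -[leRHS]mulr1 -[leRHS]mulr1.
have [Sx dx] := ramp_funP x k0; have [Sy dy] := ramp_funP y k0.
by apply: L_bound => // z _; rewrite ?dx ?dy normc_real ramp_norm.
Qed.

Lemma L_ramp_step k s t i j : 0 < k -> L (ramp_step k s i) (ramp_step k t j) =
  ((rect_incr (approx_u k) (s i) (s i.+1) (t j) (t j.+1))%:C)%C.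
Proof.
move=> k0; have S x := (ramp_funP x k0).1.
have Lr x : L (ramp_fun k x) (ramp_step k t j) =
    -1 * L (ramp_fun k x) (ramp_fun k (t j)) + L (ramp_fun k x) (ramp_fun k (t j.+1)).
  exact: (L_linr (-1) (S (t j)) (S (t j.+1)) (S x)).
have -> : L (ramp_step k s i) (ramp_step k t j) =
    -1 * L (ramp_fun k (s i)) (ramp_step k t j) + L (ramp_fun k (s i.+1)) (ramp_step k t j).
  exact: (L_linl (-1) (S (s i)) (S (s i.+1)) (ramp_stepP t j k0).1).
by rewrite !Lr !approx_uE// /rect_incr rmorphD !rmorphB/=; ring.
Qed.

Lemma riemann_sumE k m n (s t : nat -> R) (a b : nat -> C) : 0 < k ->
  \sum_(i < m) \sum_(j < n) a i * b j *
    ((rect_incr (approx_u k) (s i) (s i.+1) (t j) (t j.+1))%:C)%C =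
  L (comb m a (ramp_step k s)) (comb n b (ramp_step k t)).
Proof.
move=> k0; rewrite L_comb => [|i|j]; try exact: (ramp_stepP _ _ k0).1.
by apply: eq_bigr => i _; apply: eq_bigr => j _; rewrite L_ramp_step.
Qed.

Lemma classS_ramp_comb k m (s : nat -> R) (a : nat -> C) : 0 < k ->
  classS (comb m a (ramp_step k s)).
Proof. by move=> k0; apply: classS_comb => i; exact: (ramp_stepP _ _ k0).1. Qed.

Lemma cderive_ramp_comb k m (s : nat -> R) (a : nat -> C) y : 0 < k ->
  cderive (comb m a (ramp_step k s)) y = \sum_(i < m) a i * ((ramp_incr M k s i y)%:C)%C.
Proof.
move=> k0; rewrite cderive_comb => [|i]; last exact: (ramp_stepP _ _ k0).1.
by apply: eq_bigr => i _; rewrite (ramp_stepP _ _ k0).2.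
Qed.

Lemma ramp_comb_bound k m s (a : nat -> C) (A y : R) : 0 < k -> is_partition M m s ->
  y <= M -> (forall i, (i < m)%N -> normc (a i) <= A) ->
  normc (cderive (comb m a (ramp_step k s)) y) <= A.
Proof.
move=> k0 ps yM aA; rewrite cderive_ramp_comb// -[X in normc X]subr0.
by apply: ramp_comb_approx => // i im _; rewrite subr0 aA.
Qed.

(** The double sum is one value of [L], at functions whose derivatives are convex combinations of
    the coefficients. The modulus is never taken inside the sum, which is why the Frechet variation,
    not the total variation, is controlled. *)
Lemma riemann_sum_bound k m n (s t : nat -> R) (a b : nat -> C) (A B : R) : 0 < k ->
  is_partition M m s -> is_partition M n t ->
  (forall i, (i < m)%N -> normc (a i) <= A) ->
  (forall j, (j < n)%N -> normc (b j) <= B) ->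
  normc (\sum_(i < m) \sum_(j < n) a i * b j *
    ((rect_incr (approx_u k) (s i) (s i.+1) (t j) (t j.+1))%:C)%C) <= K * A * B.
Proof.
move=> k0 ps pt aA bB; rewrite riemann_sumE//.
apply: L_bound; try exact: classS_ramp_comb.
- by move=> x /andP[_ xM]; exact: ramp_comb_bound.
- by move=> x /andP[_ xM]; exact: ramp_comb_bound.
Qed.

Lemma riemann_sum_approx k m n (s t xi eta : nat -> R) f g (A B e1 e2 : R) : 0 < k ->
  is_partition M m s -> is_partition M n t -> classS f -> classS g ->
  (forall x, - M <= x <= M -> normc (cderive f x) <= A) ->
  (forall x, - M <= x <= M -> normc (cderive g x) <= B) ->
  is_tagging m s xi -> is_tagging n t eta ->
  (forall x y, - M <= x <= M -> `|x - y| <= mesh m s + k^-1 ->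
    normc (cderive f x - cderive f y) <= e1) ->
  (forall x y, - M <= x <= M -> `|x - y| <= mesh n t + k^-1 ->
    normc (cderive g x - cderive g y) <= e2) ->
  normc (\sum_(i < m) \sum_(j < n) cderive f (xi i) * cderive g (eta j) *
    ((rect_incr (approx_u k) (s i) (s i.+1) (t j) (t j.+1))%:C)%C - L f g) <=
  K * e1 * B + K * A * e2.
Proof.
move=> k0 ps pt Sf Sg fA gB tx te fe ge.
rewrite (riemann_sumE _ _ _ _ (fun i => cderive f (xi i)) (fun j => cderive g (eta j)) k0).
set F := comb m _ _; set G := comb n _ _.
have SF : classS F by exact: classS_ramp_comb.
have SG : classS G by exact: classS_ramp_comb.
(* In each term one argument has a small derivative by uniform continuity, while the other keeps its
   bound [B] or [A]. *)
have -> : L F G - L f g = L (fun x => -1 * f x + F x) G + L f (fun x => -1 * g x + G x).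
  by rewrite L_linl// L_linr//; ring.
rewrite (le_trans (normcD _ _))// lerD//; apply: L_bound => //; try exact: classS_lin.
- move=> x /[dup] xM /andP[Mx xM'].
  rewrite (C1_lin (-1) Sf.1 SF.1).2 mulN1r addrC cderive_ramp_comb//.
  apply: (@ramp_comb_approx _ _ M_gt0 k m s x (fun i => cderive f (xi i))) => //.
  move=> i im nz; apply: fe; first exact: tag_in ps tx im.
  exact: (ramp_incr_supp k0 ps im Mx (tx i im) nz).
- move=> x /andP[_ xM]; apply: ramp_comb_bound => // j jn.
  by apply: gB; exact: tag_in pt te jn.
- move=> x /[dup] xM /andP[Mx xM'].
  rewrite (C1_lin (-1) Sg.1 SG.1).2 mulN1r addrC cderive_ramp_comb//.
  apply: (@ramp_comb_approx _ _ M_gt0 k n t x (fun i => cderive g (eta i))) => //.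
  move=> i im nz; apply: ge; first exact: tag_in pt te im.
  exact: (ramp_incr_supp k0 pt im Mx (te i im) nz).
Qed.

Lemma cderive_unif f (e : R) : C1 f -> 0 < e -> exists2 d : R, 0 < d &
  forall x y, - M <= x <= M -> `|x - y| < d -> normc (cderive f x - cderive f y) <= e.
Proof.
move=> [_ _ cr ci] e0; have e2 : 0 < e / 2 by rewrite divr_gt0.
have [d1 d10 h1] := @continuous_unif_seg R _ (- M) M _ cr e2.
have [d2 d20 h2] := @continuous_unif_seg R _ (- M) M _ ci e2.
exists (Num.min d1 d2); first by rewrite lt_min d10.
move=> x y xM; rewrite lt_min => /andP[xy1 xy2].
rewrite (le_trans (normc_le_ReIm _))// [leRHS](splitr e) lerD// ltW//.
  exact: h1.
exact: h2.
Qed.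

Lemma frechet_representation : exists u : R -> R -> R, bounded_frechet_variation M u /\
  forall f g, classS f -> classS g ->
    is_frechet_integral M u (cderive f) (cderive g) (L f g).
Proof.
have [U [PU ooU lim]] := ultralimit R.
have slope n : 0 < (n.+1%:R : R) by rewrite ltr0n.
have /choice[u1 uP1] : forall xy : R * R, exists l, forall e, 0 < e ->
    \forall n \near U, `|approx_u n.+1%:R xy.1 xy.2 - l| < e.
  by move=> [x y]; apply: (lim _ K) => n; exact: approx_u_le.
pose u x y := u1 (x, y).
have uP x y : ccvg U (fun n => ((approx_u n.+1%:R x y)%:C)%C) ((u x y)%:C)%C.
  move=> e e0; apply: filterS (uP1 (x, y) e e0) => n h.
  by rewrite -rmorphB normc_real.
have rectE (v : R -> R -> R) x y z w : ((rect_incr v x y z w)%:C)%C =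
    -1 * ((v y z)%:C)%C + (-1 * ((v x w)%:C)%C + (((v y w)%:C)%C + ((v x z)%:C)%C)) :> C.
  by rewrite /rect_incr rmorphD !rmorphB/=; ring.
have rectP x y z w : ccvg U (fun n => ((rect_incr (approx_u n.+1%:R) x y z w)%:C)%C)
    ((rect_incr u x y z w)%:C)%C.
  rewrite rectE; under eq_fun do rewrite rectE.
  exact: (ccvg_lin (-1) (uP _ _) (ccvg_lin (-1) (uP _ _) (ccvgD (uP _ _) (uP _ _)))).
(* For a fixed partition only finitely many values of [u] occur, so pointwise convergence along [U]
   suffices. *)
have sumP m n (s t : nat -> R) (a b : nat -> C) : ccvg U (fun k =>
    \sum_(i < m) \sum_(j < n) a i * b j *
      ((rect_incr (approx_u k.+1%:R) (s i) (s i.+1) (t j) (t j.+1))%:C)%C)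
    (\sum_(i < m) \sum_(j < n) a i * b j *
      ((rect_incr u (s i) (s i.+1) (t j) (t j.+1))%:C)%C).
  apply: ccvg_sum => i; apply: ccvg_sum => j; rewrite -[X in ccvg _ _ X]addr0.
  under eq_fun do rewrite -[_ * _ * _]addr0.
  exact: (ccvg_lin (a i * b j) (rectP _ _ _ _) (ccvg_cst 0)).
exists u; split.
  exists K => m n s t sigma theta ps pt.
  pose sg (x : nat -> bool) i : C := (((-1) ^+ x i : R)%:C)%C.
  have sg1 x i : normc (sg x i) <= 1.
    by rewrite normc_real normrX normrN1 expr1n.
  rewrite -normc_real rmorph_sum/=.
  under eq_bigr do rewrite rmorph_sum/=.
  under eq_bigr do under eq_bigr do rewrite !rmorphM/=.
  apply: (ccvg_le (sumP m n s t (sg sigma) (sg theta))) => e e0.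
  near=> k; rewrite (@le_trans _ _ K)//; last by rewrite lerDl ltW.
  rewrite -[leRHS]mulr1 -[leRHS]mulr1.
  by apply: riemann_sum_bound.
move=> f g Sf Sg e e0.
pose A := supnorm_seg M (cderive f); pose B := supnorm_seg M (cderive g).
have fA x : - M <= x <= M -> normc (cderive f x) <= A by exact: le_supnorm_seg Sf.1.
have gB x : - M <= x <= M -> normc (cderive g x) <= B by exact: le_supnorm_seg Sg.1.
have M0 : - M <= 0 <= M by rewrite oppr_le0 !ltW.
have A0 : 0 <= A := le_trans (normc_ge0 _) (fA 0 M0).
have B0 : 0 <= B := le_trans (normc_ge0 _) (gB 0 M0).
(* The 1 keeps [D] positive when both derivatives vanish on the segment. With accuracy [r] for both
   derivatives the error [K * r * B + K * A * r] is at most [r * D = e / 2]. *)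
pose D := K * (A + B + 1); have D0 : 0 < D by rewrite mulr_gt0//; lra.
pose r := e / 2 / D; have r0 : 0 < r by rewrite !divr_gt0.
have [d1 d10 h1] := cderive_unif Sf.1 r0.
have [d2 d20 h2] := cderive_unif Sg.1 r0.
pose dl := Num.min d1 d2; have dl0 : 0 < dl by rewrite lt_min d10.
(* One half of [dl] is for the mesh, the other for the ramp width [k.+1%:R^-1], which is eventually
   smaller along [U] since [U] contains [\oo]. The mesh condition does not depend on [k], so the
   limit can be taken with the partition fixed. *)
exists (dl / 2); first by rewrite divr_gt0.
move=> m n s t xi eta ps pt tx te ms mt.
(* Passing to the limit yields a weak inequality, while the definition of the integral asks for a
   strict one. *)
apply: (@le_lt_trans _ _ (e / 2)); last by rewrite ltr_pdivrMr// ltr_pMr// ltr1n.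
set I := L f g.
have cI : ccvg U (fun k => \sum_(i < m) \sum_(j < n) cderive f (xi i) * cderive g (eta j) *
      ((rect_incr (approx_u k.+1%:R) (s i) (s i.+1) (t j) (t j.+1))%:C)%C + - I)
    (\sum_(i < m) \sum_(j < n) cderive f (xi i) * cderive g (eta j) *
      ((rect_incr u (s i) (s i.+1) (t j) (t j.+1))%:C)%C + - I).
  exact: (ccvgD (sumP m n s t (fun i => cderive f (xi i)) (fun j => cderive g (eta j)))
    (ccvg_cst (- I))).
apply: (ccvg_le cI) => e1 e10.
have near_k : \forall k \near U, k.+1%:R^-1 < dl / 2.
  by apply: ooU; apply: near_infty_natSinv_lt (PosNum _); rewrite divr_gt0.
apply: filterS near_k => k kd.
have le_e : K * r * B + K * A * r <= e / 2 + e1.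
  have -> : K * r * B + K * A * r = r * D - K * r by rewrite /D; ring.
  have -> : r * D = e / 2 by rewrite /r divfK// lt0r_neq0.
  have : 0 <= K * r by rewrite mulr_ge0// ltW.
  lra.
apply: le_trans le_e; apply: riemann_sum_approx => //.
- move=> x y xM xy; apply: h1 => //; apply: (le_lt_trans xy).
  by rewrite (@lt_le_trans _ _ dl)// ?ge_min ?lexx// [ltRHS](splitr dl) ltrD.
- move=> x y xM xy; apply: h2 => //; apply: (le_lt_trans xy).
  by rewrite (@lt_le_trans _ _ dl)// ?ge_min ?lexx ?orbT// [ltRHS](splitr dl) ltrD.
Unshelve. all: by end_near. Qed.

End Frechet.

(** * Covariances of polynomials *)

Section RealCovariance.
Context d (T : measurableType d) (R : realType) (P : probability T R).
Local Notation C := R[i].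

Lemma Im_cexpectation (Z : T -> C) : (forall w, complex.Im (Z w) = 0) ->
  complex.Im (cexpectation P Z) = 0.
Proof.
move=> Z0; rewrite cexpectationE /=; under eq_Rintegral do rewrite Z0.
exact: mean_cst.
Qed.

Lemma Im_mul_real (z w : C) : complex.Im z = 0 -> complex.Im w = 0 -> complex.Im (z * w) = 0.
Proof. by case: z w => a b [x y] /= -> ->; rewrite mulr0 mul0r addr0. Qed.

Lemma Im_ccovariance (Z W : T -> C) : (forall w, complex.Im (Z w) = 0) ->
  (forall w, complex.Im (W w) = 0) -> complex.Im (ccovariance P Z W) = 0.
Proof.
move=> Z0 W0; rewrite /ccovariance Im_add -[- _]mulN1r Im_mul_real ?addr0.
- by apply: Im_cexpectation => w; exact: Im_mul_real.
- by rewrite /= oppr0.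
- by apply: Im_mul_real; exact: Im_cexpectation.
Qed.

End RealCovariance.

Section PolynomialCovariance.
Context (R : realType) (d : nat -> measure_display)
    (T : forall N, measurableType (d N)) (P : forall N, probability (T N) R)
    (X : forall N, T N -> 'M[R[i]]_N).
Arguments X : clear implicits.
Hypothesis X_ens : selfadjoint_ensemble P X.
Context (alpha2 : nat -> nat -> R[i]).
Hypothesis lim_covariances : forall m n : nat, (0 < m)%N -> (0 < n)%N ->
  (fun N : nat =>
     ccovariance (P N) (fun w => \tr (X N w ^+ m))
                       (fun w => \tr (X N w ^+ n)) : R[i]^o) @ \oo
    --> (alpha2 m n : R[i]^o).
Context (rho : {biscalar {poly R[i]}}).
Hypothesis rho_monomials : forall m n : nat, (0 < m)%N -> (0 < n)%N ->
  rho 'X^m 'X^n = alpha2 m n.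
Hypothesis rho_const : forall n : nat, rho 1 'X^n = 0 /\ rho 'X^n 1 = 0.
Local Notation C := R[i].

Let monomial (i : nat) : R -> C := poly_fun 'X^i.

Lemma classS_monomial i : classS (monomial i).
Proof. exact: classS_poly. Qed.

Lemma poly_fun_comb p : poly_fun p = comb (size p) (fun i => p`_i) monomial.
Proof.
apply/funext => x; rewrite /poly_fun horner_coef /comb; apply: eq_bigr => i _.
by rewrite /monomial /poly_fun hornerXn.
Qed.

Lemma trf_monomial i N w : trf (monomial i) (X N w) = \tr (X N w ^+ i).
Proof.
rewrite tr_expmx; last exact: (X_ens N).1.1.
rewrite /trf /sum_eig rmorph_sum/=; apply: eq_bigr => k _.
by rewrite /monomial /poly_fun hornerXn rmorphXn.
Qed.

Lemma classS_cov_linl N (a : C) f g h : classS f -> classS g -> classS h ->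
  cov P X N (fun x => a * f x + g x) h = a * cov P X N f h + cov P X N g h.
Proof.
by move=> /classSP[_ tf] /classSP[_ tg] /classSP[_ th]; exact: cov_linl.
Qed.

Lemma classS_cov_linr N (a : C) f g h : classS f -> classS g -> classS h ->
  cov P X N h (fun x => a * f x + g x) = a * cov P X N h f + cov P X N h g.
Proof.
by move=> /classSP[_ tf] /classSP[_ tg] /classSP[_ th]; exact: cov_linr.
Qed.

(** The trace of the identity is the deterministic number [N]. This matches the convention that
    [rho] vanishes on constants. *)
Lemma cov_monomial0 N g : classS g -> cov P X N (monomial 0) g = 0.
Proof.
move=> /classSP[_ tg]; rewrite /cov.
have -> : (fun w => trf (monomial 0) (X N w)) = fun=> (N%:R : C).
  apply/funext => w; rewrite /trf.
  under eq_bigr do rewrite /monomial /poly_fun hornerXn expr0.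
  by rewrite sumr_const card_ord.
apply: ccovariance_cst; apply: cL2_trf tg; first exact: (X_ens N).1.1.
exact: (X_ens N).2.
Qed.

Lemma cvg_cov_monomial m n : ccvg \oo (fun N => cov P X N (monomial m) (monomial n))
  (rho 'X^m 'X^n).
Proof.
case: m => [|m].
  rewrite expr0 (rho_const n).1 (_ : (fun N => _) = fun=> 0); first exact: ccvg_cst.
  by apply/funext => N; apply: cov_monomial0; exact: classS_monomial.
case: n => [|n].
  rewrite expr0 (rho_const m.+1).2 (_ : (fun N => _) = fun=> 0); first exact: ccvg_cst.
  by apply/funext => N; rewrite covC; apply: cov_monomial0; exact: classS_monomial.
rewrite rho_monomials//; have /ccvgP := lim_covariances (ltn0Sn m) (ltn0Sn n).
rewrite /cov; congr ccvg; apply/funext => N.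
by congr (ccovariance (P N)); apply/funext => w; rewrite trf_monomial.
Qed.

Lemma rho_sum p q : rho p q =
  \sum_(i < size p) \sum_(j < size q) p`_i * q`_j * rho 'X^i 'X^j.
Proof.
rewrite -{1}[p]coefK -{1}[q]coefK !poly_def linear_sumlz; apply: eq_bigr => i _.
rewrite linear_sumr; apply: eq_bigr => j _.
by rewrite linearZlr /= mulrA.
Qed.

Lemma cvg_cov_poly p q : ccvg \oo (fun N => cov P X N (poly_fun p) (poly_fun q)) (rho p q).
Proof.
rewrite rho_sum [poly_fun p]poly_fun_comb [poly_fun q]poly_fun_comb.
(* At fixed [N] the covariance is bilinear on the class, so the expansion proved for the abstract
   form [L] applies to it. *)
under eq_fun do rewrite (L_comb (@classS_cov_linl _) (@classS_cov_linr _) _ _ _ _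
  classS_monomial classS_monomial).
apply: ccvg_sum => i; apply: ccvg_sum => j; rewrite -[X in ccvg _ _ X]addr0.
under eq_fun do rewrite -[_ * _ * _]addr0.
exact: (ccvg_lin _ (cvg_cov_monomial i j) (ccvg_cst 0)).
Qed.

End PolynomialCovariance.

(** Integrands are sampled at tags only, and tags lie in [[-M, M]], the only place where an
    extension and the original function have to agree. *)
Lemma is_frechet_integral_eq (R : realType) (M : R) (u : R -> R -> R)
    (f1 g1 f2 g2 : R -> R[i]) I :
  (forall x, - M <= x <= M -> f1 x = f2 x) -> (forall x, - M <= x <= M -> g1 x = g2 x) ->
  is_frechet_integral M u f1 g1 I -> is_frechet_integral M u f2 g2 I.
Proof.
move=> f12 g12 fg e e0; have [dl dl0 h] := fg e e0; exists dl => //.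
move=> m n s t xi eta ps pt tx te ms mt; have := h m n s t xi eta ps pt tx te ms mt.
congr (normc (_ - _) < _); apply: eq_bigr => i _; apply: eq_bigr => j _.
by rewrite f12 ?g12//; [exact: tag_in pt te (ltn_ord j)|exact: tag_in ps tx (ltn_ord i)].
Qed.

Theorem theorem6 (R : realType) (d : nat -> measure_display)
    (T : forall N, measurableType (d N)) (P : forall N, probability (T N) R)
    (X : forall N, T N -> 'M[R[i]]_N)
    (X_ens : selfadjoint_ensemble P X)
    (M K : R) (M_gt0 : 0 < M) (K_gt0 : 0 < K)
    (alpha1 : nat -> R[i]) (alpha2 : nat -> nat -> R[i])
    (lim_moments : forall n : nat, (0 < n)%N ->
      (fun N : nat => (N%:R)^-1 *
         cexpectation (P N) (fun w => \tr (X N w ^+ n)) : R[i]^o) @ \oo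
        --> (alpha1 n : R[i]^o))
    (lim_covariances : forall m n : nat, (0 < m)%N -> (0 < n)%N ->
      (fun N : nat =>
         ccovariance (P N) (fun w => \tr (X N w ^+ m))
                           (fun w => \tr (X N w ^+ n)) : R[i]^o) @ \oo
        --> (alpha2 m n : R[i]^o))
    (norm_tail :
      (fun N : nat =>
         ((N%:R ^+ 8)%:E * P N [set w | (M < opnorm (X N w))%R])%E) @ \oo
        --> (0%E : \bar R))
    (var_bound : forall (f : R -> R[i]) (N : nat), C1 f ->
      (cvariance (P N) (fun w => trf f (X N w))
         <= K%:E * supnorm (cderive f) ^+ 2)%E)
    (rho : {biscalar {poly R[i]}})
    (rho_monomials : forall m n : nat, (0 < m)%N -> (0 < n)%N ->
      rho 'X^m 'X^n = alpha2 m n)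
    (rho_const : forall n : nat, rho 1 'X^n = 0 /\ rho 'X^n 1 = 0) :
  exists rhoM : (seg M -> R[i]) -> (seg M -> R[i]) -> R[i],
    [/\ (* (a) *)
        [/\ forall p q : {poly R[i]},
              rhoM (restr (poly_fun p)) (restr (poly_fun q)) = rho p q,
            bilinear_on (C1seg (M:=M)) rhoM
          & forall f g : R -> R[i], C1 f -> C1 g ->
              normc (rhoM (restr f) (restr g))
                <= K * supnorm_seg M (cderive f) * supnorm_seg M (cderive g)],
        (* (b) *)
        forall f g : R -> R[i], classS f -> classS g ->
          (fun N : nat =>
             ccovariance (P N) (fun w => trf f (X N w))
                               (fun w => trf g (X N w)) : R[i]^o) @ \oo
            --> (rhoM (restr f) (restr g) : R[i]^o)
      & (* (c) *)
        exists u : R -> R -> R, bounded_frechet_variation M u /\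
          forall f g : R -> R[i], C1 f -> C1 g ->
            is_frechet_integral M u (cderive f) (cderive g)
              (rhoM (restr f) (restr g))].
Proof.
pose c := cov P X.
have c_sym N f g : c N f g = c N g f by exact: covC.
have c_linl N := @classS_cov_linl R d T P X X_ens N.
have c_limsup := cov_limsup X_ens M_gt0 K_gt0 lim_moments norm_tail var_bound.
have c_tail f g : classS f -> classS g ->
    (forall x, - M <= x <= M -> f x = 0) -> ccvg \oo (fun N => c N f g) 0.
  by move=> /classSP[_ tf] /classSP[_ tg]; exact: (cov_tail X_ens M_gt0 lim_moments norm_tail).
have c_poly := cvg_cov_poly X_ens lim_covariances rho_monomials rho_const.
exists (segform c); split.
- split.
  + exact: (segform_poly M_gt0 K_gt0 c_sym c_linl c_limsup c_tail c_poly).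
  + exact: (segform_bilinear M_gt0 K_gt0 c_sym c_linl c_limsup c_tail c_poly).
  + move=> f g.
    exact: (segform_bound M_gt0 K_gt0 c_sym c_linl c_limsup c_tail c_poly).
- move=> f g Sf Sg; apply/ccvgP.
  exact: (segform_cvg M_gt0 K_gt0 c_sym c_linl c_limsup c_tail c_poly).
(* Covariances of real statistics are real, hence so are their limits; this makes [u]
   real-valued. *)
have L_real f g : classS f -> classS g -> (forall x, complex.Im (f x) = 0) ->
    (forall x, complex.Im (g x) = 0) -> complex.Im (limform c f g) = 0.
  move=> Sf Sg f0 g0.
  have cl := limformP M_gt0 K_gt0 c_sym c_linl c_limsup c_poly Sf Sg.
  have trf0 (h : R -> R[i]) N w : (forall x, complex.Im (h x) = 0) ->
      complex.Im (trf h (X N w)) = 0.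
    by move=> h0; rewrite Im_trf /sum_eig big1.
  apply/eqP; rewrite -normr_le0; apply/ler_addgt0Pr => e e0; rewrite add0r.
  near \oo => N.
  have h : normc (c N f g - limform c f g) < e by near: N; exact: cl.
  have cN : complex.Im (c N f g) = 0.
    by apply: Im_ccovariance => w; exact: trf0.
  apply: le_trans (ltW h); apply: le_trans (normIm_le _).
  by move: cN; case: (c N f g) (limform c f g) => a b [p q] /= ->; rewrite sub0r normrN.
have [u [bu iu]] := frechet_representation M_gt0 K_gt0
  (limform_linl M_gt0 K_gt0 c_sym c_linl c_limsup c_poly)
  (limform_linr M_gt0 K_gt0 c_sym c_linl c_limsup c_poly)
  (limform_bound M_gt0 K_gt0 c_sym c_linl c_limsup c_poly) L_real.
exists u; split => // f g Cf Cg.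
(* The representation is known on the class [classS]; an arbitrary C1 function is replaced by its
   extension, which changes neither the form nor the integral. *)
have [f1 [Sf1 ff1 df1 _]] := C1_extension M_gt0 Cf.
have [g1 [Sg1 gg1 dg1 _]] := C1_extension M_gt0 Cg.
rewrite (segformE M_gt0 K_gt0 c_sym c_linl c_limsup c_tail c_poly Cf Cg Sf1 Sg1)//.
exact: is_frechet_integral_eq df1 dg1 (iu f1 g1 Sf1 Sg1).
Unshelve. all: by end_near. Qed.
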